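(* Let $(\Omega,\mathcal F,(\mathcal F_A)_{A\in\mathcal A},\mathbb P)$ be a complete probability space with a set-indexed filtration, and let $X=\{X_A;A\in\mathcal A\}$ be an $E$-valued $\mathcal C$-Markov process w.r.t. $(\mathcal F_A)_{A\in\mathcal A}$. For all $C=A\setminus B\in\mathcal C$, define $$P_C(\mathbf x_C;\Gamma):=\mathbb P(X_A\in\Gamma\mid\mathbf X_C=\mathbf x_C),\qquad\mathbf x_C\in E^{|\mathcal A_C|},\ \Gamma\in\mathcal E.$$ Then the collection $\mathcal P=\{P_C(\mathbf x_C;\mathrm dy);\,C\in\mathcal C\}$ is a $\mathcal C$-transition system.
   Context: Indexing collection. $\mathcal T$ is a locally compact metric space and $(E,d_E)$ is a locally compact separable metric space with Borel $\sigma$-field $\mathcal E$. The indexing collection $\mathcal A$ is a class of compact subsets of $\mathcal T$ such that: (i) $\mathcal A$ is closed under arbitrary intersections and $A^\circ\neq A$ for all $A\in\mathcal A$, $A\neq\mathcal T$; (ii) $\emptyset':=\bigcap_{A\in\mathcal A}A$ is nonempty; (iii) there is an increasing sequence $(B_n)_{n\in\mathbf N}$ in $\mathcal A$ with $\mathcal T=\bigcup_nB_n$; (iv) (Shape) if $A,A_1,\dots,A_k\in\mathcal A$ and $A\subseteq\bigcup_{i=1}^kA_i$ then $A\subseteq A_i$ for some $i$. Increments. $\mathcal A(u)$ is the class of (nonempty) finite unions of sets of $\mathcal A$, and $\mathcal C$ is the class of increments $C=A\setminus B$, $A\in\mathcal A$, $B\in\mathcal A(u)$. To $C$ one associates $A$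 and $B$ with $C=A\setminus B$, $B\subseteq A$, $B=\bigcup_{i=1}^kA_i$ being the extremal representation ($A_i\in\mathcal A$, $A_i\not\subseteq A_j$ for $i\ne j$). Let $\mathcal A_\ell$ be the set of all intersections of nonempty subfamilies of $\{A_1,\dots,A_k\}$, and $\mathcal A_C=\{U\in\mathcal A_\ell;\ U\not\subseteq B^\circ\}=\{U_C^1,\dots,U_C^p\}$, $p=|\mathcal A_C|$. For a process $X$, $\mathbf X_C=(X_{U_C^1},\dots,X_{U_C^p})$; similarly $\mathbf x_C=(x_{U_C^1},\dots,x_{U_C^p})\in E^{|\mathcal A_C|}$. Filtrations. A filtration $(\mathcal F_A)_{A\in\mathcal A}$ is an increasing family of complete sub-$\sigma$-fields. For $B\in\mathcal A(u)$, $\mathcal F_B=\bigvee_{A\in\mathcal A,A\subseteq B}\mathcal F_A$, and for $C\in\mathcal C$, $\mathcal G^*_C=\bigvee_{B\in\mathcal A(u),\,B\cap C=\emptyset}\mathcal F_B$. $\mathcal C$-Markov property. An $E$-valued process $X=\{X_A;A\in\mathcal A\}$ is $\mathcal C$-Markov w.r.t. $(\mathcal F_A)$ if it is adapted and, for all $C=A\setminus B\in\mathcal C$ and all bounded measurable $f:E\to\mathbf R$, $\mathbb E[f(X_A)\mid\mathcal G^*_C]=\mathbb E[f(X_A)\mid\mathbf X_C]$ a.s. $\mathcal C$-transition system. A collection $\mathcal P=\{P_C(\mathbf x_C;\mathrm dx_A);C\in\mathcal C\}$ such that: 1. for all $C\in\mathcal C$, $P_C$ is a transition probability: $P_C(\mathbf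 x_C;\cdot)$ is a probability measure on $(E,\mathcal E)$ for all $\mathbf x_C\in E^{|\mathcal A_C|}$ and $P_C(\cdot;\Gamma)$ is measurable for all $\Gamma\in\mathcal E$; 2. $P_\emptyset(x;\Gamma)=\delta_x(\Gamma)$ for all $x\in E$, $\Gamma\in\mathcal E$; 3. (Chapman–Kolmogorov) for all $C=A\setminus B\in\mathcal C$ and $A'\in\mathcal A$, with $C'=C\cap A'$ and $C''=C\setminus A'$, $$P_C(\mathbf x_C;\Gamma)=\int_EP_{C'}(\mathbf x_{C'};\mathrm dx_{A'})\,P_{C''}(\mathbf x_{C''};\Gamma)$$ for all $\mathbf x_C,\mathbf x_{C'},\mathbf x_{C''}$ and $\Gamma\in\mathcal E$. Here components of the three vectors indexed by the same set of $\mathcal A$ are equal; when $A'\subseteq A$ and $A'\not\subseteq B$ one has $A'\in\mathcal A_{C''}$, and the component $x_{A'}$ of $\mathbf x_{C''}$ is the integration variable. If $A'\subseteq B$ or $A\subseteq A'$ then $C'$ or $C''$ is empty and the equation is trivially true; if $A'\not\subseteq A$, $A'$ is to be read as $A\cap A'$, which gives the same $C',C''$.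
   Formalization: Chapman–Kolmogorov and P_∅ = δ are proved for almost every x under the law of X (all Γ at once), for any versions of P_C, instead of for all x, where the claim can fail; versions are shown to exist, with P_∅(x;·) = δ_x for all x. *)

(* Defs.v *)
From HB Require Import structures.
From mathcomp Require Import all_boot all_order all_algebra.
From mathcomp Require Import all_classical all_reals all_analysis.

Set Implicit Arguments.
Unset Strict Implicit.
Unset Printing Implicit Defensive.

Import Order.TTheory GRing.Theory Num.Theory.
Import numFieldNormedType.Exports.

Local Open Scope classical_set_scope.
Local Open Scope ring_scope.

(* Measurable types of MathComp-Analysis are pointed, so the state space has to
   be pointed as well; the value space of a process is never empty. *)
#[short(type="pmetricType")]
HB.structure Definition PointedMetric (K : numDomainType) :=
  {M of Metric K M & Pointed M}.

Notation borel E := (g_sigma_algebraType (@open E)).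

Definition separable_space (E : topologicalType) : Prop :=
  exists2 D : set E, countable D & dense D.

Section indexing.
Context {R : realType} {T : metricType R}.
Implicit Types (AA F : set (set T)) (A B U : set T).

Record indexing_collection AA : Prop := {
  indexing_compact : forall A, AA A -> compact A;
  indexing_bigcap : forall F, F `<=` AA -> F !=set0 ->
    AA (\bigcap_(V in F) V);
  indexing_interior : forall A, AA A -> A <> [set: T] -> A° <> A;
  indexing_bottom : \bigcap_(A in AA) A !=set0;
  indexing_exhaust : exists S : nat -> set T,
    [/\ forall n, AA (S n), forall n, S n `<=` S n.+1
      & \bigcup_n S n = [set: T]];
  indexing_shape : forall A F, AA A -> finite_set F -> F `<=` AA ->
    A `<=` \bigcup_(V in F) V -> exists2 V, F V & A `<=` V }.

Definition finite_unions AA B : Prop :=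
  exists F, [/\ finite_set F, F !=set0, F `<=` AA & B = \bigcup_(V in F) V].

(* An increment C is represented by its associated pair (A, B), C = A \ B. By
   the shape property the pair is determined by C as soon as C is nonempty; the
   empty increment corresponds to all the pairs (A, A). *)
Definition increment AA A B : Prop :=
  [/\ AA A, finite_unions AA B & B `<=` A].

Definition extremal AA B F : Prop :=
  [/\ finite_set F /\ F !=set0, F `<=` AA, B = \bigcup_(V in F) V
    & forall V W, F V -> F W -> V `<=` W -> V = W].

(* The collection A_l of the intersections of extremal components of B. *)
Definition extremal_meets AA B : set (set T) :=
  [set U | exists F H, [/\ extremal AA B F, H `<=` F, H !=set0
                         & U = \bigcap_(V in H) V]].

(* The collection A_C for C = A \ B. For the empty increment (A, A), where
   extremal_meets AA A = [set A], it has to be {A}, since x_C is then a single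
   state x_A; this already follows from [~ U `<=` B°], except when A is the
   whole space T, which is the only case where the last disjunct matters. *)
Definition increment_index AA A B : set (set T) :=
  [set U | extremal_meets AA B U /\ (~ U `<=` B° \/ A `\` B = set0)].

End indexing.

Section states.
Context {R : realType} {T : metricType R} {E : pmetricType R}.
Implicit Types (AA : set (set T)) (A B : set T).

Definition cylinders (I : Type) : set (set (I -> E)) :=
  [set D | exists (i : I) (G : set (borel E)),
     measurable G /\ D = [set x | G (x i)]].

(* The product space E^(A_C) with its product sigma-algebra. *)
Definition state AA A B :=
  g_sigma_algebraType (@cylinders {U : set T | increment_index AA A B U}).

(* The vector x_C extracted from a family x = (x_U). Components of x_C, x_C'
   and x_C'' with the same index are equal since they come from the same x. *)
Definition restr AA A B (x : set T -> E) : state AA A B :=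
  fun U => x (sval U).

Arguments restr : clear implicits.

Definition update (x : set T -> E) A (y : E) : set T -> E :=
  fun U => if `[< U = A >] then y else x U.

Definition transition_family AA :=
  forall A B, R.-pker (state AA A B) ~> (borel E).

(* The set system Q on the families x = (x_U) says for which x the identities
   are required: for every x when Q = globally setT, for almost every x under
   the law of X when Q = path_law P X. The latter is the sense in which they can
   hold for conditional laws, which are only defined up to null sets. *)
Definition empty_is_dirac AA (Q : set_system (set T -> E))
    (p : transition_family AA) : Prop :=
  forall A, AA A ->
  Q [set x | forall G : set (borel E), measurable G ->
    p A A (restr AA A A x) G = (\d_(x A : borel E) G)%E].

(* A' is read as A `&` A', so that C' = C `&` A' has the associated pair
   (A `&` A', A `&` A' `&` B) and C'' = C `\` A' the pair
   (A, A `&` (A' `|` B)). *)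
Definition chapman_kolmogorov AA (Q : set_system (set T -> E))
    (p : transition_family AA) : Prop :=
  forall A B A', increment AA A B -> AA A' ->
  Q [set x | forall G : set (borel E), measurable G ->
    p A B (restr AA A B x) G =
    (\int[p (A `&` A') (A `&` A' `&` B) (restr AA _ _ x)]_(y in setT)
       p A (A `&` (A' `|` B)) (restr AA _ _ (update x (A `&` A') y)) G)%E].

Definition C_transition_system AA (Q : set_system (set T -> E))
    (p : transition_family AA) : Prop :=
  empty_is_dirac Q p /\ chapman_kolmogorov Q p.

End states.

Arguments restr {R T E} AA A B x.

Section conditioning.
Context {R : realType} {d : measure_display} {Omega : measurableType d}.
Variable P : probability Omega R.

Definition is_cond_exp (G : set_system Omega) (Y Z : Omega -> R) : Prop :=
  [/\ forall S, measurable S -> G (Z @^-1` S),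
      P.-integrable setT (EFin \o Z)
    & forall D, G D ->
        (\int[P]_(w in D) (Z w)%:E = \int[P]_(w in D) (Y w)%:E)%E].

(* A version of E[Y | G], for Y integrable and G a sub-sigma-algebra. *)
Definition cond_exp (G : set_system Omega) (Y : Omega -> R) : Omega -> R :=
  get [set Z | is_cond_exp G Y Z].

End conditioning.

Section markov.
Context {R : realType} {T : metricType R} {E : pmetricType R}.
Context {d : measure_display} {Omega : measurableType d}.
Variables (P : probability Omega R) (AA : set (set T)).
Implicit Types (FF : set T -> set_system Omega) (X : set T -> Omega -> E).

Record filtration FF : Prop := {
  filtration_sigma_algebra : forall A, AA A -> sigma_algebra setT (FF A);
  filtration_measurable : forall A, AA A -> FF A `<=` measurable;
  filtration_complete : forall A, AA A -> P.-negligible `<=` FF A;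
  filtration_le : forall A B, AA A -> AA B -> A `<=` B -> FF A `<=` FF B }.

Definition filtration_union FF (B : set T) : set_system Omega :=
  <<s \bigcup_(A in [set A | AA A /\ A `<=` B]) FF A >>.

(* The strong history G*_C of C. *)
Definition strong_history FF (C : set T) : set_system Omega :=
  <<s \bigcup_(B in [set B | finite_unions AA B /\ B `&` C = set0])
        filtration_union FF B >>.

Definition adapted FF X : Prop :=
  forall A, AA A -> forall G : set (borel E), measurable G ->
    FF A (X A @^-1` G).

(* The random vector X_C. *)
Definition process_at X (A B : set T) (w : Omega) : state AA A B :=
  restr AA A B (fun U => X U w).

Arguments process_at : clear implicits.

Definition C_Markov FF X : Prop :=
  adapted FF X /\
  forall A B, increment AA A B ->
  forall f : borel E -> R, measurable_fun setT f -> [bounded f x | x in setT] ->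
    {ae P, forall w,
      cond_exp P (strong_history FF (A `\` B)) (f \o X A) w =
      cond_exp P (g_sigma_algebra_preimage (process_at X A B)) (f \o X A) w}.

(* p A B is a regular version of x |-> P (X_A \in . | X_C = x). *)
Definition conditional_laws X (p : transition_family AA) : Prop :=
  forall A B, increment AA A B ->
  forall G : set (borel E), measurable G ->
    {ae P, forall w,
      p A B (process_at X A B w) G =
      (cond_exp P (g_sigma_algebra_preimage (process_at X A B))
         \1_(X A @^-1` G) w)%:E}.

Definition path_law X : set_system (set T -> E) :=
  [set D | {ae P, forall w, D (fun U => X U w)}].

End markov.

Arguments process_at {R T E d Omega} AA X A B w.

(* Main.v *)
Require Import Defs.
From HB Require Import structures.
From mathcomp Require Import all_boot all_order all_algebra.
From mathcomp Require Import all_classical all_reals all_analysis.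
From mathcomp Require Import measurable_realfun lra.

(** Every component of [X_C''] other than [X_A'] is measurable for the strong
    history [G*_C], because a set [U] of the index of [C''] satisfies [U = A']
    or [U `<=` B]. Conditioning [f (X_A)] on the larger history [G*_C''] gives
    [P_C'' f (X_C'')], a function of [X_A'] with [G*_C]-measurable parameters;
    conditioning it further on [G*_C] integrates [X_A'] against [P_C' (X_C')].
    Hence both sides of the Chapman-Kolmogorov equation at a fixed event are
    versions of the same conditional probability given [G*_C], and a countable
    pi-system generating the Borel sets of [E] makes the exceptional null set
    uniform in the event.

    Regular versions exist because [E] is a Borel retract of the real line:
    a point is coded by the ternary expansion of the indicator functions of a
    countable base of balls, and decoded as the limit of the centers of the
    balls containing it; local compactness makes the domain of convergence
    measurable. For a real variable, the conditional law is the law of the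
    conditional quantile function of a uniform variable. *)

Set Implicit Arguments.
Unset Strict Implicit.
Unset Printing Implicit Defensive.

Import Order.TTheory GRing.Theory Num.Theory.
Import numFieldNormedType.Exports.

Local Open Scope classical_set_scope.
Local Open Scope ring_scope.

(** * Conditional probabilities *)

Section finite_measure_of.
Context {d : measure_display} {T : measurableType d} {R : realType}.
Variable m : {measure set T -> \bar R}.

(** An alias of [m] that carries the proof [fm] in its type, so that a finite measure structure can
    be attached to it, as Radon-Nikodym requires. *)
Definition finite_measure_of (fm : fin_num_fun m) : set T -> \bar R := m.

Hypothesis fm : fin_num_fun m.

HB.instance Definition _ := Measure.on (finite_measure_of fm).
HB.instance Definition _ := Measure_isFinite.Build _ _ _
  (finite_measure_of fm) fm.

End finite_measure_of.

(** * Conditional probabilities as functions of a random element *)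

Section conditional_density.
Context {R : realType} {d d' : measure_display} {Omega : measurableType d}
  {S : measurableType d'}.
Variables (P : probability Omega R) (h : Omega -> S).
Local Open Scope ereal_scope.

(** Here [g x] is the elementary conditional probability of [F] given [h = x]. It is a function on
    the value space, so no factorization through [h] is needed afterwards. *)
Definition cond_density (F : set Omega) (g : S -> \bar R) : Prop :=
  [/\ forall x, 0 <= g x, forall x, g x \is a fin_num,
    measurable_fun setT g &
    forall D, measurable D ->
      \int[P]_(w in h @^-1` D) g (h w) = P (h @^-1` D `&` F)].

Hypothesis mh : measurable_fun [set: Omega] h.

Let mhV D : measurable D -> measurable (h @^-1` D).
Proof. by move=> mD; rewrite -[X in measurable X]setTI; exact: mh. Qed.

(** The measure [D |-> P (h @^-1 D]&[F)] is dominated by the law of [h], and [g] is its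
    Radon-Nikodym derivative. *)
Lemma conditional_density (F : set Omega) : measurable F ->
  exists g, cond_density F g.
Proof.
move=> mF.
pose mu0 := (pushforward P h : {measure set S -> \bar R}).
pose nu0 := (pushforward (mrestr P mF) h : {measure set S -> \bar R}).
have fmu : fin_num_fun (mu0 mh).
  by move=> D mD; apply: fin_num_measure; exact: mhV.
have fnu : fin_num_fun (nu0 mh).
  move=> D mD; rewrite /= /pushforward /mrestr.
  by apply: fin_num_measure; apply: measurableI => //; exact: mhV.
pose muf : {finite_measure set S -> \bar R} := finite_measure_of fmu.
pose nuf : {finite_measure set S -> \bar R} := finite_measure_of fnu.
have numu : nuf `<< muf.
  apply/null_content_dominatesP => A mA A0.
  apply/eqP; rewrite eq_le measure_ge0 andbT -A0.
  apply: le_measure; rewrite ?inE; [|exact: mhV|exact: subIsetl].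
  by apply: measurableI => //; exact: mhV.
have [g [g0 gfin gi gE]] := radon_nikodym_sigma_finite numu.
have mg := measurable_int _ gi.
exists g; split => // D mD.
have := gE _ mD; rewrite (eq_measure_integral (mu0 mh))//.
rewrite ge0_integral_pushforward//.
exact: measurable_funTS.
Qed.

(** Under the law of [h] the two functions have the same integral over every measurable set, so they
    differ on a null set, whose preimage by [h] is [P]-null. *)
Lemma conditional_density_unique (f g : S -> \bar R) :
  measurable_fun setT f -> measurable_fun setT g ->
  P.-integrable setT (f \o h) -> P.-integrable setT (g \o h) ->
  (forall D, measurable D ->
    \int[P]_(w in h @^-1` D) f (h w) = \int[P]_(w in h @^-1` D) g (h w)) ->
  {ae P, forall w, f (h w) = g (h w)}.
Proof.
move=> mf mg fi gi fg.
have fiD D : measurable D -> P.-integrable (h @^-1` D) (f \o h).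
  by move=> mD; apply: integrableS fi => //; exact: mhV.
have giD D : measurable D -> P.-integrable (h @^-1` D) (g \o h).
  by move=> mD; apply: integrableS gi => //; exact: mhV.
pose mu0 := (pushforward P h : {measure set S -> \bar R}).
have : ae_eq (mu0 mh) setT f g.
  apply: integral_ae_eq => //.
    by apply: integrable_pushforward => //; exact: fiD.
  move=> D _ mD.
  rewrite /mu0/= !integral_pushforward//; [exact: fg|exact: giD|exact: fiD].
case=> N [mN N0 fgN]; exists (h @^-1` N); split => //; first exact: mhV.
by move=> w /= fgw; apply: fgN => /= /(_ I).
Qed.

End conditional_density.

(** * Conditional probabilities given a sub-sigma-algebra *)

Section conditional_probability.
Context {R : realType} {d : measure_display} {Omega : measurableType d}.
Variables (P : probability Omega R) (G : set_system Omega).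
Hypotheses (sG : sigma_algebra setT G) (mG : G `<=` measurable).
Local Open Scope ereal_scope.

Definition cond_prob_version (F : set Omega) (Z : Omega -> \bar R) : Prop :=
  [/\ measurable_fun (setT : set (g_sigma_algebraType G)) Z,
      P.-integrable setT Z
    & forall D, G D -> \int[P]_(w in D) Z w = P (D `&` F)].

(** Conditioning on [G] amounts to conditioning on the identity, seen as a random element of [Omega]
    equipped with [G]. The results on densities thus apply with [h = id]. *)
Lemma measurable_id_sub_sigma_algebra :
  measurable_fun setT (id : Omega -> g_sigma_algebraType G).
Proof.
by move=> _ A; rewrite setTI preimage_id measurable_g_measurableTypeE// => /mG.
Qed.

Lemma cond_prob_version_unique F Z1 Z2 :
  cond_prob_version F Z1 -> cond_prob_version F Z2 ->
  {ae P, forall w, Z1 w = Z2 w}.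
Proof.
move=> [mZ1 iZ1 Z1E] [mZ2 iZ2 Z2E].
apply: (conditional_density_unique measurable_id_sub_sigma_algebra) => //.
by move=> D; rewrite measurable_g_measurableTypeE// => GD; rewrite Z1E ?Z2E.
Qed.

(** [cond_exp] is selected by [get], so its properties hold once some version exists; the density of
    [F] with respect to the identity map provides one. *)
Lemma cond_exp_indicP F : measurable F ->
  cond_prob_version F (EFin \o cond_exp P G \1_F).
Proof.
move=> mF.
have intF D : G D -> \int[P]_(w in D) (\1_F w)%:E = P (D `&` F).
  by move=> GD; rewrite integral_indic//; [rewrite setIC|exact: mG].
have [mZ iZ ZE] : is_cond_exp P G \1_F (cond_exp P G \1_F).
  apply: (@getPex _ [set Z | is_cond_exp P G \1_F Z]).
  have [g [g0 gfin mg gE]] :=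
    conditional_density P measurable_id_sub_sigma_algebra mF.
  have gEF w : (fine (g w))%:E = g w by rewrite fineK.
  exists (fine \o g); split.
  - move=> S mS; rewrite -[G _]/((G : set (set Omega)) _).
    rewrite -(measurable_g_measurableTypeE sG) -[X in measurable X]setTI.
    exact: (measurableT_comp (fine_measurable measurableT) mg).
  - apply/integrableP; split.
      have -> : EFin \o (fine \o g) = g by apply/funext => w /=; rewrite gEF.
      exact: (measurableT_comp mg measurable_id_sub_sigma_algebra).
    have -> : EFin \o (fine \o g) = g by apply/funext => w /=; rewrite gEF.
    under eq_integral do rewrite gee0_abs//.
    have := gE _ measurableT; rewrite preimage_setT /= => ->.
    by rewrite setTI (le_lt_trans (probability_le1 P mF))// ltry.
  - move=> D GD; rewrite intF// -gE ?preimage_id//.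
      by under eq_integral do rewrite /= gEF.
    by rewrite measurable_g_measurableTypeE.
split => //.
  apply/measurable_EFinP => _ S mS.
  rewrite setTI measurable_g_measurableTypeE//.
  exact: mZ.
by move=> D GD; rewrite -intF// -ZE.
Qed.

Lemma cond_prob_version_cond_exp F Z : measurable F ->
  cond_prob_version F Z ->
  {ae P, forall w, Z w = (cond_exp P G \1_F w)%:E}.
Proof.
move=> mF ZF; have := cond_prob_version_unique ZF (cond_exp_indicP mF).
by [].
Qed.

(** [Z] is only measurable for the full sigma-algebra: being almost surely equal to a version is
    enough to compute its integrals over the events of [G]. *)
Lemma integral_ae_cond_exp F (Z : Omega -> \bar R) D : measurable F -> G D ->
  measurable_fun setT Z ->
  {ae P, forall w, Z w = (cond_exp P G \1_F w)%:E} ->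
  \int[P]_(w in D) Z w = P (D `&` F).
Proof.
move=> mF GD mZ ZE; have [_ iY <-//] := cond_exp_indicP mF.
have mD := mG GD.
apply: ae_eq_integral => //; first exact: measurable_funTS.
  by apply: measurable_funTS; exact: measurable_int iY.
by apply: filterS ZE => w + _.
Qed.

End conditional_probability.

(** * Disintegration of a joint law *)

Section disintegration.
Context {R : realType} {d d1 d2 : measure_display} {Omega : measurableType d}
  {T1 : measurableType d1} {T2 : measurableType d2}.
Local Open Scope ereal_scope.

Section graph_kernel.
Variable k : R.-pker T1 ~> T2.

(** The law of [(x, y)] for [y] drawn from [k x]. The dummy [unit] component matches the format of
    kernel composition, whose second kernel also sees the source of the first. *)
Definition graph_kernel (x : unit * T1) : {measure set (T1 * T2) -> \bar R}.
Proof.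
pose m := pushforward (k x.2) (pair x.2) : {measure set (T1 * T2) -> \bar R}.
exact: (m (pair1_measurable x.2)).
Defined.

Let graph_kernelE x U : graph_kernel x U = k x.2 (xsection U x.2).
Proof. by rewrite /graph_kernel /= /pushforward xsectionE. Qed.

Let measurable_graph_kernel U : measurable U ->
  measurable_fun setT (graph_kernel ^~ U).
Proof.
move=> mU; under eq_fun do rewrite graph_kernelE.
apply: (measurableT_comp (f := fun x => k x (xsection U x))) => //.
by apply: measurable_fun_xsection_finite_kernel; rewrite inE.
Qed.

HB.instance Definition _ := isKernel.Build _ _ _ _ R graph_kernel
  measurable_graph_kernel.

Let graph_kernel_prob x : graph_kernel x setT = 1.
Proof.
by rewrite /graph_kernel/= /pushforward preimage_setT prob_kernel.
Qed.

HB.instance Definition _ := Kernel_isProbability.Build _ _ _ _ R graph_kernel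
  graph_kernel_prob.

End graph_kernel.

(** The joint law of [(a, Y)] and the composition of the law of [a] with the graph kernel agree on
    rectangles, which form a generating pi-system. Integrating [f] against either one gives the two
    sides. *)
Lemma disintegration (P : probability Omega R) (a : Omega -> T1)
    (Y : Omega -> T2) (k : R.-pker T1 ~> T2) :
  measurable_fun setT a -> measurable_fun setT Y ->
  (forall D B, measurable D -> measurable B ->
    \int[P]_(w in a @^-1` D) k (a w) B = P (a @^-1` D `&` Y @^-1` B)) ->
  forall f : T1 * T2 -> \bar R, measurable_fun setT f -> (forall z, 0 <= f z) ->
  \int[P]_w f (a w, Y w) = \int[P]_w \int[k (a w)]_y f (a w, y).
Proof.
move=> ma mY kE f mf f0.
pose a' : {mfun Omega >-> T1} := HB.pack a (isMeasurableFun.Build _ _ _ _ _ ma).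
have maY : measurable_fun setT (fun w => (a w, Y w)).
  exact: measurable_fun_pair.
pose law0 := pushforward P (fun w => (a w, Y w)) : {measure set _ -> \bar R}.
pose law := law0 maY.
pose l : R.-pker unit ~> T1 :=
  kprobability (measurable_cst (distribution P a' : pprobability T1 R)).
have intl (g : T1 -> \bar R) : measurable_fun setT g -> (forall x, 0 <= g x) ->
    \int[l tt]_x g x = \int[P]_w g (a w).
  by move=> mg g0; rewrite ge0_integral_pushforward.
have lawE U : measurable U -> law U = (l \; graph_kernel k) tt U.
  apply: (measure_unique [set A `*` B | A in measurable & B in measurable]
            (fun=> setT)).
  - by rewrite measurable_prod_measurableType.
  - move=> _ _ [A1 mA1 [B1 mB1 <-]] [A2 mA2 [B2 mB2 <-]].
    exists (A1 `&` A2); first exact: measurableI.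
    by exists (B1 `&` B2); [exact: measurableI|rewrite setXI].
  - by move=> _; exists setT => //; exists setT => //; rewrite setXTT.
  - by rewrite bigcup_const.
  - move=> _ [D mD [B mB <-]].
    rewrite [RHS](_ : _ = \int[l tt]_x graph_kernel k (tt, x) (D `*` B))//.
    rewrite intl//; last first.
      have mDB := measurable_kernel (graph_kernel k) _ (measurableX mD mB).
      exact: (measurableT_comp mDB (pair1_measurable tt)).
    rewrite [LHS](_ : _ = P (a @^-1` D `&` Y @^-1` B))// -kE//.
    rewrite [LHS]integral_mkcond; apply: eq_integral => w _.
    rewrite patchE /graph_kernel /= /pushforward -xsectionE.
    rewrite -[w \in _]/(a w \in D).
    case: ifPn => aD; first by rewrite in_xsectionX.
    by rewrite notin_xsectionX// measure0.
  - by move=> _; rewrite [ltLHS](_ : _ = P setT)// probability_setT ltry.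
have -> : \int[P]_w f (a w, Y w) = \int[law]_z f z.
  by rewrite /law /law0 /= ge0_integral_pushforward.
rewrite (eq_measure_integral ((l \; graph_kernel k) tt)); last first.
  by move=> A mA _; exact: lawE.
rewrite integral_kcomp//.
under eq_integral do rewrite /graph_kernel /= ge0_integral_pushforward//=.
rewrite intl//.
- apply: (measurable_fun_integral_finite_kernel f k) => //.
- by move=> x; exact: integral_ge0.
Qed.

End disintegration.

(** * The state space as a Borel retract of the real line *)

Section separable_metric.
Context {R : realType} {E : pmetricType R}.
Hypothesis E_sep : separable_space E.

Lemma ball_open_metric (x : E) (r : R) : open (ball x r).
Proof.
rewrite openE => y; rewrite ballEmdist /= => xyr.
apply/nbhs_ballP; exists (r - mdist x y) => /=; first by rewrite subr_gt0.
move=> z; rewrite !ballEmdist /= => yz.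
by rewrite (le_lt_trans (metric_triangle _ y _))// -ltrBrDl.
Qed.

Lemma dense_sequence :
  exists c : nat -> E,
    forall (y : E) (e : R), 0 < e -> exists n, ball (c n) e y.
Proof.
have [D cD dD] := E_sep.
have [D0|[f]] := (pfcard_geP cD).
  by have [x []] := dD setT (ex_intro _ point I) openT; rewrite D0.
exists f => y e e0.
have [|z [yz Dz]] := dD (ball y e) _ (ball_open_metric y e).
  by exists y; exact: ballxx.
have [n _ nz] := @surj _ _ _ _ f z Dz.
by exists n; rewrite nz; exact: ball_sym.
Qed.

Definition inv_succ (q : nat) : R := q.+1%:R^-1.

Lemma inv_succ_gt0 q : 0 < inv_succ q. Proof. by rewrite invr_gt0. Qed.

Lemma inv_succ_lt (e : R) : 0 < e -> exists q, inv_succ q < e.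
Proof.
move=> e0; have [q] := ltr_add_invr e0; rewrite add0r => qe; by exists q.
Qed.

Variable c : nat -> E.
Hypothesis cE : forall (y : E) (e : R), 0 < e -> exists n, ball (c n) e y.

Definition basic_ball (i : nat * nat) : set E := ball (c i.1) (inv_succ i.2).

Lemma open_bigcup_basic_ball (O : set E) : open O ->
  O = \bigcup_(i in [set i | basic_ball i `<=` O]) basic_ball i.
Proof.
move=> oO; apply/seteqP; split => [y Oy|y [i iO]]; last exact: iO.
have /nbhs_ballP[e /= e0 yeO] := open_nbhs_nbhs (conj oO Oy).
have [q qe] := @inv_succ_lt (e / 2) (divr_gt0 e0 (ltr0n _ 2)).
have [n ny] := cE y (inv_succ_gt0 q).
exists (n, q) => //= z nz; apply: yeO; rewrite (splitr e).
apply: (@ball_triangle _ _ (c n)).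
  by apply/ball_sym; apply: le_ball ny; exact: ltW.
by apply: le_ball nz; exact: ltW.
Qed.

Lemma measurable_basic_ball i : measurable (basic_ball i : set (borel E)).
Proof. by apply: sub_sigma_algebra; exact: ball_open_metric. Qed.

(** Finite sequences as indices make the family countable and stable under intersection, by
    concatenation; the empty sequence gives the whole space. *)
Definition finite_meet (s : seq (nat * nat)) : set (borel E) :=
  \big[setI/setT]_(i <- s) basic_ball i.

Lemma measurable_finite_meet s : measurable (finite_meet s).
Proof. by apply: bigsetI_measurable => i _; exact: measurable_basic_ball. Qed.

Lemma borel_finite_meet :
  (measurable : set (set (borel E))) = <<s range finite_meet >>.
Proof.
apply/seteqP; split; last first.
  apply: smallest_sub; first exact: sigma_algebra_measurable.
  by move=> _ [s _ <-]; exact: measurable_finite_meet.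
apply: smallest_sub; first exact: smallest_sigma_algebra.
move=> O /open_bigcup_basic_ball ->.
rewrite bigcup_mkcond.
apply: (@countable_bigcupT_measurable _
  (g_sigma_algebraType (range finite_meet)) _ _ (countableP _)) => i.
case: ifP => _; last exact: measurable0.
apply: sub_sigma_algebra; exists [:: i] => //.
by rewrite /finite_meet big_seq1.
Qed.

Lemma eq_measure_finite_meet (m1 m2 : {measure set (borel E) -> \bar R}) :
  (m1 setT < +oo)%E -> (forall s, m1 (finite_meet s) = m2 (finite_meet s)) ->
  forall A, measurable A -> m1 A = m2 A.
Proof.
move=> m1oo m12; apply: (measure_unique (range finite_meet) (fun=> setT)) => //.
- exact: borel_finite_meet.
- move=> _ _ [s _ <-] [t _ <-]; exists (s ++ t) => //.
  by rewrite /finite_meet big_cat.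
- by move=> _; exists [::] => //; rewrite /finite_meet big_nil.
- by rewrite bigcup_const.
- by move=> _ [s _ <-].
Qed.

End separable_metric.

(** * Measurability of pointwise limits *)

Section limits.
Context {R : realType} {E : pmetricType R} {d : measure_display}
  {T : measurableType d}.
Hypotheses (E_lc : locally_compact [set: E]).
Variable c : nat -> E.
Hypothesis cE : forall (y : E) (e : R), 0 < e -> exists n, ball (c n) e y.
Variable f : nat -> T -> borel E.
Hypothesis mf : forall n, measurable_fun setT (f n).

Definition eventually_in (B : set (borel E)) : set T :=
  \bigcup_N \bigcap_(n in [set n | (N <= n)%N]) (f n @^-1` B).

Lemma eventually_inP B x :
  eventually_in B x <-> \forall n \near \oo, B (f n x).
Proof.
split=> [[N _ NB]|[N _ NB]]; first by exists N => // n /NB.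
by exists N => // n /NB.
Qed.

Lemma measurable_eventually_in B : measurable B -> measurable (eventually_in B).
Proof.
move=> mB; apply: bigcupT_measurable => N; apply: bigcap_measurable.
  by exists N => /=.
by move=> n _; rewrite -[X in measurable X]setTI; exact: mf.
Qed.

(** The first factor keeps the sequence eventually in a compact set, the second is the Cauchy
    condition. Both only involve countably many balls, hence measurability; together they amount to
    convergence. *)
Definition limit_domain : set T :=
  (\bigcup_(i in [set i | exists2 K, compact K & basic_ball c i `<=` K])
     eventually_in (basic_ball c i)) `&`
  \bigcap_q \bigcup_n eventually_in (basic_ball c (n, q)).

Lemma measurable_limit_domain : measurable limit_domain.
Proof.
apply: measurableI.
  rewrite bigcup_mkcond.
  apply: (countable_bigcupT_measurable (countableP _)) => i.
  case: ifP => _ //.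
  by apply: measurable_eventually_in; exact: measurable_basic_ball.
apply: bigcapT_measurable => q; apply: bigcupT_measurable => n.
by apply: measurable_eventually_in; exact: measurable_basic_ball.
Qed.

Lemma limit_domainP x : limit_domain x <-> cvg (f n x @[n --> \oo]).
Proof.
split.
- move=> [[i [K cK iK] /eventually_inP xi] xC].
  apply: (@compact_cauchy_cvg _ K) => //; last exact: filterS iK xi.
  apply: cauchy_exP => e e0.
  have [q qe] := inv_succ_lt e0.
  have [n _ /eventually_inP nqx] := xC q I.
  exists (c n); apply: filterS nqx => m.
  by apply: le_ball; exact: ltW.
- move=> fx; set l := lim (f n x @[n --> \oo]).
  have fl O : open O -> O l -> eventually_in O x.
    by move=> oO Ol; apply/eventually_inP; apply: fx; exact: open_nbhs_nbhs.
  split.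
    have [K lK [cK _]] := @E_lc l I.
    have {lK} lK : K° l.
      by move: lK; rewrite /within /= near_simpl; apply: filterS => y; exact.
    have := lK; rewrite [X in X l -> _](open_bigcup_basic_ball cE)//; last first.
      exact: open_interior.
    move=> [i /= iK il]; exists i.
      by exists K => //; apply: subset_trans iK _; exact: interior_subset.
    by apply: fl => //; exact: ball_open_metric.
  move=> q _; have [n nl] := cE l (inv_succ_gt0 q); exists n => //.
  by apply: fl => //; exact: ball_open_metric.
Qed.

Definition limit (x : T) : borel E :=
  if `[< limit_domain x >] then lim (f n x @[n --> \oo]) else point.

Lemma measurable_limit : measurable_fun setT limit.
Proof.
apply: (@measurability _ _ T (borel E) setT limit (@open E))
  => [//|_ [V oV <-]].
rewrite setTI.
(* A sequence that stays in a ball may converge to a boundary point. Asking [V] to contain the ball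
   of doubled radius keeps the limit inside [V]. *)
pose I := [set i | ball (c i.1) (inv_succ i.2 *+ 2) `<=` V].
have -> : limit @^-1` V =
    limit_domain `&` (\bigcup_(i in I) eventually_in (basic_ball c i)) `|`
    (~` limit_domain `&` (cst (point : borel E) : T -> borel E) @^-1` V).
  apply/seteqP; split => x.
  - rewrite /limit /=; case: asboolP => xD; last by right.
    move=> Ol; left; split => //.
    have {}xD := (limit_domainP x).1 xD.
    have /nbhs_ballP[e /= e0 eO] := open_nbhs_nbhs (conj oV Ol).
    have e30 : 0 < e / 3 by rewrite divr_gt0.
    have [q qe] := inv_succ_lt e30.
    have [n nl] := cE (lim (f n x @[n --> \oo])) (inv_succ_gt0 q).
    exists (n, q) => /=; last first.
      apply/eventually_inP; apply: xD; apply: open_nbhs_nbhs; split => //.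
      exact: ball_open_metric.
    move=> z nz; apply: eO.
    have -> : e = e / 3 + (e / 3 *+ 2) by lra.
    apply: (@ball_triangle _ _ (c n)).
      by apply/ball_sym; apply: le_ball nl; exact: ltW.
    by apply: le_ball nz; rewrite ler_pMn2r// ltW.
  - rewrite /limit /=; case: asboolP => xD; last by move=> [[]|[]].
    move=> [[_ [i iO /eventually_inP xi]]|[]//].
    have {}xD := (limit_domainP x).1 xD.
    apply: iO.
    have : nbhs (lim (f n x @[n --> \oo]))
             (ball (lim (f n x @[n --> \oo])) (inv_succ i.2)).
      by apply: nbhsx_ballx; exact: inv_succ_gt0.
    move=> /xD xl.
    have [m [im ml]] := filter_ex (filterI xi xl).
    rewrite mulr2n; apply: (@ball_triangle _ _ (f m x)) => //.
    exact: ball_sym.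
have mD := measurable_limit_domain.
apply: measurableU; apply: measurableI => //.
- rewrite bigcup_mkcond.
  apply: (countable_bigcupT_measurable (countableP _)) => i.
  case: ifP => _ //.
  by apply: measurable_eventually_in; exact: measurable_basic_ball.
- exact: measurableC.
- rewrite -[X in measurable X]setTI; apply: measurable_cst => //.
  exact: sub_sigma_algebra.
Qed.

End limits.

Section first_index.
Context {d : measure_display} {T : measurableType d}.
Variable A : nat -> set T.

(** The sets [seqDU A n] are disjoint, so at most one index qualifies, the least [n] with [A n x].
    Outside the union the value is 0. *)
Definition first_index (x : T) : nat := xget 0%N [set n | seqDU A n x].

Lemma first_indexP n x : A n x -> A (first_index x) x.
Proof.
move=> Anx; have : (\bigcup_n A n) x by exists n.
rewrite seqDU_bigcup_eq => -[m _ Amx].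
by have [] := xgetPex 0%N (ex_intro [set n | seqDU A n x] m Amx).
Qed.

Lemma measurable_first_index : (forall n, measurable (A n)) ->
  measurable_fun setT first_index.
Proof.
move=> mA.
have mD n : measurable (seqDU A n) by exact: seqDU_measurable.
have mC : measurable (~` \bigcup_n A n).
  by apply: measurableC; exact: bigcupT_measurable.
move=> _ B _; rewrite setTI.
have -> : first_index @^-1` B =
    \bigcup_(n in B) seqDU A n `|` (~` (\bigcup_n A n) `&` [set _ | B 0%N]).
  apply/seteqP; split => x.
    move=> Bx; have [xA|xA] := pselect ((\bigcup_n A n) x); last first.
      right; split => //=; move: Bx; rewrite /first_index /= xgetPN// => n nx.
      by apply: xA; rewrite seqDU_bigcup_eq; exists n.
    left; exists (first_index x) => //.
    move: xA; rewrite seqDU_bigcup_eq => -[m _ Amx].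
    exact: (xgetPex 0%N (ex_intro [set n | seqDU A n x] m Amx)).
  move=> [[n Bn nx]|[xA B0]].
    rewrite /= /first_index (@xget_unique _ _ _ n)// => m mx.
    exact: (@trivIset_seqDU _ A m n I I (ex_intro _ x (conj mx nx))).
  rewrite /= /first_index xgetPN// => n nx.
  by apply: xA; rewrite seqDU_bigcup_eq; exists n.
apply: measurableU; first exact: bigcup_measurable.
apply: measurableI => //.
have [B0|B0] := pselect (B 0%N).
  by rewrite [X in measurable X](_ : _ = setT)//; apply/seteqP; split.
by rewrite [X in measurable X](_ : _ = set0)//; apply/seteqP; split.
Qed.

End first_index.

(** * Coding of binary sequences by the Cantor set *)

Section ternary.
Context {R : realType}.
Implicit Types b : nat -> bool.

(** Partial sums of the expansion in base 3 with digits 0 and 2, the first digit being [b 0].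
    Recursion on the shifted sequence yields the functional equation of the limit directly. *)
Fixpoint ternary_sum n b : R :=
  if n is n.+1 then
    ((if b 0%N then 2 else 0) + ternary_sum n (b \o succn)) / 3
  else 0.

Lemma ternary_sumS n b : ternary_sum n.+1 b =
  ((if b 0%N then 2 else 0) + ternary_sum n (b \o succn)) / 3.
Proof. by []. Qed.

Definition ternary b : R := limn (ternary_sum ^~ b).

Lemma ternary_sum_itv n b : 0 <= ternary_sum n b <= 1.
Proof.
elim: n b => [|n IH] b /=; first by rewrite lexx ler01.
have := IH (b \o succn); move: (ternary_sum _ _) => t /andP[t0 t1].
by case: (b 0%N); apply/andP; split; lra.
Qed.

Lemma nondecreasing_ternary_sum b : nondecreasing_seq (ternary_sum ^~ b).
Proof.
apply/nondecreasing_seqP => n; elim: n b => [|n IH] b.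
  by have /andP[] := ternary_sum_itv 1 b.
have := IH (b \o succn); rewrite (ternary_sumS n b) (ternary_sumS n.+1 b).
by move: (ternary_sum n _) (ternary_sum n.+1 _) => x y xy; case: (b 0%N); lra.
Qed.

Lemma cvg_ternary_sum b : ternary_sum n b @[n --> \oo] --> ternary b.
Proof.
apply: nondecreasing_is_cvgn; first exact: nondecreasing_ternary_sum.
by exists 1 => _ [n _ <-]; have /andP[] := ternary_sum_itv n b.
Qed.

Lemma ternary_itv b : 0 <= ternary b <= 1.
Proof.
apply/andP; split.
  apply: limr_ge; first by apply/cvg_ex; eexists; exact: cvg_ternary_sum.
  by apply: nearW => n; have /andP[] := ternary_sum_itv n b.
apply: limr_le; first by apply/cvg_ex; eexists; exact: cvg_ternary_sum.
by apply: nearW => n; have /andP[] := ternary_sum_itv n b.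
Qed.

Lemma ternaryS b :
  ternary b = ((if b 0%N then 2 else 0) + ternary (b \o succn)) / 3.
Proof.
apply: cvg_lim => //; rewrite -(cvg_shiftS (ternary_sum ^~ b)) /=.
apply: cvgM; last exact: cvg_cst.
by apply: cvgD; [exact: cvg_cst|exact: cvg_ternary_sum].
Qed.

(** The left inverse of prefixing a digit. A first digit 0 gives a value at most 1/3 and a digit 2 a
    value at least 2/3, so comparison with 1/2 recovers it without the ambiguity of binary
    expansions. *)
Definition ternary_shift (r : R) : R := 3 * r - (if 2^-1 <= r then 2 else 0).

Definition ternary_digit (j : nat) (r : R) : bool :=
  2^-1 <= iter j ternary_shift r.

Lemma ternary_digit0 b : ternary_digit 0 (ternary b) = b 0%N.
Proof.
rewrite /ternary_digit /= ternaryS.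
have /andP[? ?] := ternary_itv (b \o succn).
by case: (b 0%N); [apply/idP|apply/negbTE; rewrite -ltNge]; lra.
Qed.

Lemma ternary_shiftE b : ternary_shift (ternary b) = ternary (b \o succn).
Proof.
have := ternary_digit0 b; rewrite /ternary_shift /ternary_digit /= => ->.
by rewrite ternaryS; case: (b 0%N); lra.
Qed.

Lemma ternary_digitE b j : ternary_digit j (ternary b) = b j.
Proof.
elim: j b => [|j IH] b; first exact: ternary_digit0.
by rewrite /ternary_digit iterSr ternary_shiftE; exact: IH.
Qed.

Lemma measurable_ternary_shift : measurable_fun setT ternary_shift.
Proof.
apply: measurable_funB; first exact: measurable_funM.
by apply: measurable_fun_ifT => //; exact: measurable_fun_ler.
Qed.

Lemma measurable_ternary_digit j : measurable [set r | ternary_digit j r].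
Proof.
rewrite -[X in measurable X]setTI.
have mi : measurable_fun setT (iter j ternary_shift).
  elim: j => [|j IH] /=; first exact: measurable_id.
  exact: measurableT_comp measurable_ternary_shift IH.
have := @measurable_fun_ler _ _ _ setT (cst 2^-1) _ (measurable_cst _) mi.
by move=> /(_ measurableT [set true] I).
Qed.

Lemma measurable_ternary d (T : measurableType d) (b : T -> nat -> bool) :
  (forall j, measurable_fun setT (fun x => b x j)) ->
  measurable_fun setT (fun x => ternary (b x)).
Proof.
move=> mb; apply: (measurable_fun_cvg (h := fun n x => ternary_sum n (b x))).
  move=> n; elim: n b mb => [|n IH] b mb /=; first exact: measurable_cst.
  apply: measurable_funM => //; apply: measurable_funD.
    by apply: measurable_fun_ifT.
  by apply: (IH (fun x => b x \o succn)) => j; exact: mb.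
by move=> x _; exact: cvg_ternary_sum.
Qed.

End ternary.

Lemma borel_retract (R : realType) (E : pmetricType R) :
  locally_compact [set: E] -> separable_space E ->
  exists (code : borel E -> R) (decode : R -> borel E),
    [/\ measurable_fun setT code, measurable_fun setT decode
      & cancel code decode].
Proof.
move=> E_lc E_sep; have [c cE] := dense_sequence E_sep.
(* Integers that code no pair fall back to the ball [(0, 0)]; only the bits at [pickle (n, q)] are
   read when decoding. *)
pose bit (y : borel E) j :=
  `[< basic_ball c (odflt (0, 0)%N (unpickle j)) y >].
pose center (q : nat) (r : R) :=
  first_index (fun n => [set r | ternary_digit (pickle (n, q)) r]) r.
(* The center of the first ball of radius [inv_succ q] that, according to the digits of [r],
   contains the coded point. *)
pose approx q (r : R) : borel E := c (center q r).
have mapprox q : measurable_fun setT (approx q).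
  apply: (measurableT_comp (f := c : nat -> borel E)) => //.
  by apply: measurable_first_index => n; exact: measurable_ternary_digit.
exists (fun y => ternary (bit y)), (limit c approx); split.
- apply: measurable_ternary => j.
  apply: (measurable_fun_bool true); rewrite setTI.
  rewrite [X in measurable X](_ : _ =
    basic_ball c (odflt (0, 0)%N (unpickle j))).
    exact: measurable_basic_ball.
  by apply/seteqP; split => y /= /asboolP.
- exact: measurable_limit.
- move=> y; rewrite /limit.
  have near_y q : ball y (inv_succ q) (approx q (ternary (bit y))).
    have [n ny] := cE y _ (inv_succ_gt0 q).
    apply: ball_sym.
    have : ternary_digit (pickle (center q (ternary (bit y)), q))
        (ternary (bit y) : R).
      have : [set r : R | ternary_digit (pickle (n, q)) r] (ternary (bit y)).
        by rewrite /= ternary_digitE /bit pickleK; apply/asboolP.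
      move=> /(first_indexP (A := fun n =>
        [set r : R | ternary_digit (pickle (n, q)) r])).
      by [].
    by rewrite ternary_digitE /bit pickleK => /asboolP.
  have ycvg : approx q (ternary (bit y)) @[q --> \oo] --> (y : E).
    apply/cvg_ballP => e e0; have [q qe] := inv_succ_lt e0.
    exists q => // m /= qm; apply: le_ball (near_y m).
    by rewrite (le_trans _ (ltW qe))// lef_pV2 ?posrE// ler_nat.
  case: asboolP => [_|]; first exact: (cvg_lim (@metric_hausdorff _ E) ycvg).
  by move=> []; apply/(limit_domainP E_lc cE); apply/cvg_ex; exists y.
Qed.

(** * Regular conditional laws *)

Section random_map_kernel.
Context {R : realType} {d1 d2 d3 : measure_display} {T1 : measurableType d1}
  {T2 : measurableType d2} {T3 : measurableType d3}.
Variables (U : probability T2 R) (f : T1 * T2 -> T3).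
Hypothesis mf : measurable_fun setT f.

Definition random_map_kernel (x : T1) : {measure set T3 -> \bar R}.
Proof.
pose m := pushforward U (fun u => f (x, u)) : {measure set T3 -> \bar R}.
exact: (m (measurableT_comp mf (pair1_measurable x))).
Defined.

Lemma random_map_kernelE x B : random_map_kernel x B = U [set u | B (f (x, u))].
Proof. by []. Qed.

Let measurable_random_map_kernel B : measurable B ->
  measurable_fun setT (random_map_kernel ^~ B).
Proof.
move=> mB.
have mfB : measurable (f @^-1` B).
  by rewrite -[X in measurable X]setTI; exact: mf.
have := measurable_fun_xsection U mfB.
by apply: eq_measurable_fun => x _; rewrite /= xsectionE.
Qed.

HB.instance Definition _ := isKernel.Build _ _ _ _ R random_map_kernel
  measurable_random_map_kernel.

Let random_map_kernel_prob x : random_map_kernel x setT = 1%E.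
Proof. by rewrite random_map_kernelE; exact: probability_setT. Qed.

HB.instance Definition _ := Kernel_isProbability.Build _ _ _ _ R
  random_map_kernel random_map_kernel_prob.

End random_map_kernel.

(** * Conditional distribution functions *)

Section conditional_cdf.
Context {R : realType} {d d' : measure_display} {Omega : measurableType d}
  {S : measurableType d'}.
Variables (P : probability Omega R) (h : Omega -> S) (Y : Omega -> R).
Hypotheses (mh : measurable_fun setT h) (mY : measurable_fun setT Y).
Local Open Scope ereal_scope.

Let mhV D : measurable D -> measurable (h @^-1` D).
Proof. by move=> mD; rewrite -[X in measurable X]setTI; exact: mh. Qed.

Let cond_density_integrable F g : measurable F -> cond_density P h F g ->
  P.-integrable setT (g \o h).
Proof.
move=> mF [g0 gfin mg gE]; apply/integrableP; split.
  exact: measurableT_comp mg mh.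
under eq_integral do rewrite /= gee0_abs//.
have := gE _ measurableT; rewrite preimage_setT setTI => ->.
by rewrite (le_lt_trans (probability_le1 P mF))// ltry.
Qed.

(** By uniqueness [g'] is almost surely the sum of [g] and of a density for the difference of [F']
    and [F], which is nonnegative. *)
Let cond_density_le F F' g g' : measurable F -> measurable F' -> F `<=` F' ->
  cond_density P h F g -> cond_density P h F' g' ->
  {ae P, forall w, g (h w) <= g' (h w)}.
Proof.
move=> mF mF' FF' dg dg'.
have mF'F : measurable (F' `\` F) by exact: measurableD.
have [k dk] := conditional_density P mh mF'F.
have [g0 gfin mg gE] := dg; have [g'0 g'fin mg' g'E] := dg'.
have [k0 kfin mk kE] := dk.
have ig := cond_density_integrable mF dg.
have ig' := cond_density_integrable mF' dg'.
have ik := cond_density_integrable mF'F dk.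
have : {ae P, forall w, g' (h w) = (g \+ k) (h w)}.
  apply: (conditional_density_unique mh (f := g') (g := g \+ k)) => //.
  - exact: emeasurable_funD.
  - exact: integrableD.
  - move=> D mD; rewrite ge0_integralD//; last 3 first.
    + exact: mhV.
    + by apply: measurable_funTS; exact: measurableT_comp mg mh.
    + by apply: measurable_funTS; exact: measurableT_comp mk mh.
    rewrite gE// kE// g'E// -measureU.
    + by rewrite -setIUr setDUK.
    + by apply: measurableI => //; exact: mhV.
    + by apply: measurableI => //; exact: mhV.
    + by rewrite setIACA setDIK setI0.
by apply: filterS => w ->; rewrite /= leeDl.
Qed.

Let e (n : nat) : rat := odflt 0%R (unpickle n).

Let eK q : e (pickle q) = q. Proof. by rewrite /e pickleK. Qed.

Let mYle (r : R) : measurable [set w | (Y w <= r)%R].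
Proof.
rewrite -[X in measurable X]setTI.
have -> : [set w | (Y w <= r)%R] = Y @^-1` `]-oo, r]%classic.
  by apply/seteqP; split => w /=; rewrite in_itv.
exact: mY.
Qed.

(** The densities of the events [Y <= q] are monotone in [q] and at most 1 only almost surely.
    Truncating them at 1 and taking the supremum over all rationals below [q] enforces both
    properties everywhere, and changes each density on a null set only. *)
Lemma conditional_cdf : exists F : rat -> S -> \bar R,
  [/\ forall q x, 0 <= F q x <= 1,
      forall q q' x, (q <= q')%R -> F q x <= F q' x,
      forall q, measurable_fun setT (F q)
    & forall q D, measurable D -> \int[P]_(w in h @^-1` D) F q (h w) =
        P (h @^-1` D `&` [set w | (Y w <= ratr q)%R])].
Proof.
have /choice[g dg] (q : rat) := conditional_density P mh (mYle (ratr q)).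
pose term (q : rat) n x : \bar R :=
  if (e n <= q)%R then mine (g (e n) x) 1 else 0.
pose F (q : rat) x : \bar R := ereal_sup [set term q n x | n in setT].
have term01 q n x : 0 <= term q n x <= 1.
  rewrite /term; case: ifP => _; last by rewrite lexx lee01.
  by rewrite le_min ge_min lexx orbT lee01 andbT andbT; have [] := dg (e n).
have mg q : measurable_fun setT (g q) by have [] := dg q.
have FE q x : F q x = esups (term q ^~ x) 0%N.
  by rewrite /F /esups /= /sdrop; congr ereal_sup; apply/seteqP;
    split => _ [n _ <-]; exists n.
have mF q : measurable_fun setT (F q).
  rewrite (_ : F q = fun x => esups (term q ^~ x) 0%N); last exact/funext.
  apply: (measurable_fun_esups (f := term q)) => n; rewrite /term.
  case: (e n <= q)%R; last exact: measurable_cst.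
  exact: measurable_mine.
have F01 q x : 0 <= F q x <= 1.
  apply/andP; split.
    have /andP[+ _] := term01 q 0%N x; move=> /le_trans; apply.
    by apply: ereal_sup_ubound; exists 0%N.
  by apply: ge_ereal_sup => _ [n _ <-]; have /andP[] := term01 q n x.
exists F; split => //.
- move=> q q' x qq'; apply: ge_ereal_sup => _ [n _ <-].
  rewrite {1}/term; case: ifPn => nq; last by have /andP[] := F01 q' x.
  apply: ereal_sup_ubound; exists n => //.
  by rewrite /term (le_trans nq qq').
- move=> q D mD; have [g0 gfin _ <-//] := dg q.
  apply: ge0_ae_eq_integral => //.
  + exact: mhV.
  + by apply: measurable_funTS; exact: measurableT_comp (mF q) mh.
  + by apply: measurable_funTS; exact: measurableT_comp (mg q) mh.
  + by move=> w _; have /andP[] := F01 q (h w).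
  (* The constant 1 is a density for the sure event, so monotonicity bounds the others. *)
  have ae_le1 : {ae P, forall w, forall n, g (e n) (h w) <= 1}.
    apply/ae_foralln => n.
    apply: (@cond_density_le _ setT (g (e n)) (cst 1) _ _ _ (dg (e n))) => //.
    split; [by move=> x; exact: lee01|by []|exact: measurable_cst|].
    by move=> B mB; rewrite integral_cst ?mul1e ?setIT//; exact: mhV.
  have ae_mono : {ae P, forall w, forall n, (e n <= q)%R ->
      g (e n) (h w) <= g q (h w)}.
    apply/ae_foralln => n; have [nq|nq] := boolP (e n <= q)%R.
      have : {ae P, forall w, g (e n) (h w) <= g q (h w)}.
        apply: (cond_density_le _ _ _ (dg (e n)) (dg q)) => // w /= /le_trans.
        by apply; rewrite ler_rat.
      by apply: filterS => w + _.
    by apply: aeW.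
  apply: filterS2 ae_le1 ae_mono => w gle1 gmono _.
  apply/eqP; rewrite eq_le; apply/andP; split.
    apply: ge_ereal_sup => _ [n _ <-]; rewrite /term.
    case: ifPn => // nq.
    by rewrite ge_min gmono.
  apply: ereal_sup_ubound; exists (pickle q) => //.
  rewrite /term eK lexx; apply/min_idPl.
  by rewrite -(eK q).
Qed.

End conditional_cdf.

(** * Existence of regular conditional laws *)

Section regular_conditional_law.
Context {R : realType} {d d1 : measure_display} {Omega : measurableType d}
  {S : measurableType d1}.
Variables (P : probability Omega R) (h : Omega -> S).
Hypothesis mh : measurable_fun setT h.
Local Open Scope ereal_scope.

Let mhV D : measurable D -> measurable (h @^-1` D).
Proof. by move=> mD; rewrite -[X in measurable X]setTI; exact: mh. Qed.

Lemma regular_conditional_law_pi_system d2 (T : measurableType d2)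
    (Z : Omega -> T) (k : R.-pker S ~> T) (G : set (set T)) :
  measurable_fun setT Z -> measurable = <<s G >> -> setI_closed G ->
  (forall D B, measurable D -> G B ->
    \int[P]_(w in h @^-1` D) k (h w) B = P (h @^-1` D `&` Z @^-1` B)) ->
  forall D B, measurable D -> measurable B ->
    \int[P]_(w in h @^-1` D) k (h w) B = P (h @^-1` D `&` Z @^-1` B).
Proof.
move=> mZ GE GI kG D B mD; have mhD := mhV mD.
have mZV A : measurable A -> measurable (Z @^-1` A).
  by move=> mA; rewrite -[X in measurable X]setTI; exact: mZ.
have mkh A : measurable A -> measurable_fun (h @^-1` D) (fun w => k (h w) A).
  move=> mA; apply: measurable_funTS.
  exact: measurableT_comp (measurable_kernel k _ mA) mh.
have intT : \int[P]_(w in h @^-1` D) k (h w) setT = P (h @^-1` D).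
  under eq_integral do rewrite prob_kernel.
  by rewrite integral_cst// mul1e.
rewrite [X in X B -> _]GE; move: B.
apply: (dynkin_induction GE GI).
- by rewrite preimage_setT setIT.
- by move=> B GB; exact: kG.
- move=> B mB IH.
  (* Both sums equal [P (h @^-1 D)]; the finite term given by the induction hypothesis is then
     subtracted. *)
  have : \int[P]_(w in h @^-1` D) k (h w) (~` B)
      + \int[P]_(w in h @^-1` D) k (h w) B
    = P (h @^-1` D `&` Z @^-1` (~` B)) + P (h @^-1` D `&` Z @^-1` B).
    rewrite -ge0_integralD//; [|exact/mkh/measurableC|exact: mkh].
    have kC w : k (h w) (~` B) + k (h w) B = 1.
      rewrite -measureU//; [|exact: measurableC|by rewrite setICl].
      by rewrite setUCl; exact: prob_kernel.
    under eq_integral do rewrite kC.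
    rewrite integral_cst// mul1e -measureU//.
    + by rewrite -setIUr -preimage_setU setUCl preimage_setT setIT.
    + by apply: measurableI => //; exact/mZV/measurableC.
    + by apply: measurableI => //; exact: mZV.
    + by rewrite setIACA setIid -preimage_setI setICl preimage_set0 setI0.
  rewrite IH => /(congr1 (fun x => x - P (h @^-1` D `&` Z @^-1` B))).
  have fP : P (h @^-1` D `&` Z @^-1` B) \is a fin_num.
    by apply: fin_num_measure; apply: measurableI => //; exact: mZV.
  by rewrite !addeK.
- move=> F mF tF IH; have mUF := bigcupT_measurable F mF.
  under eq_integral do rewrite measure_semi_bigcup//.
  rewrite integral_nneseries//; last by move=> n; exact: mkh.
  rewrite preimage_bigcup setI_bigcupr measure_semi_bigcup//.
  + by apply: eq_eseriesr => n _; exact: IH.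
  + by move=> n; apply: measurableI => //; exact: mZV.
  + apply/trivIsetP => i j _ _ ij; rewrite setIACA setIid -preimage_setI.
    by move/trivIsetP : tF => ->//; rewrite preimage_set0 setI0.
  + rewrite -setI_bigcupr -preimage_bigcup; apply: measurableI => //.
    exact: mZV.
Qed.

Let rational_ray : set (set \bar R) :=
  [set A | exists q : rat, A = `]-oo, (ratr q)%:E[%classic].

Let rational_rayE : (measurable : set (set \bar R)) = <<s rational_ray >>.
Proof.
have mray (r : R) : (measurable : set (set \bar R)) `]-oo, r%:E[%classic.
  exact: emeasurable_itv.
apply/seteqP; split; last first.
  apply: smallest_sub; first exact: sigma_algebra_measurable.
  by move=> _ [q ->].
rewrite [X in X `<=` _](ErealGenInftyO.measurableE R).
apply: smallest_sub; first exact: smallest_sigma_algebra.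
move=> _ [r ->].
have -> : `]-oo, r%:E[%classic =
    \bigcup_(q in [set q : rat | (ratr q < r)%R]) `]-oo, (ratr q)%:E[%classic.
  apply/seteqP; split => [z|z [q qr]] /=; rewrite !in_itv /=; last first.
    by move=> /lt_trans; apply; rewrite lte_fin.
  case: z => [z| |]//.
    rewrite lte_fin => /rat_in_itvoo[q]; rewrite in_itv /= => /andP[zq qr].
    by exists q => //=; rewrite in_itv /= lte_fin.
  move=> _; have : (r - 1 < r)%R by rewrite ltrBlDr ltrDl.
  move=> /rat_in_itvoo[q]; rewrite in_itv /= => /andP[_ qr].
  by exists q => //=; rewrite in_itv /= ltNyr.
rewrite bigcup_mkcond.
apply: (@countable_bigcupT_measurable _
  (g_sigma_algebraType rational_ray) _ _ (countableP _)) => q.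
case: ifP => _; last exact: measurable0.
by apply: sub_sigma_algebra; exists q.
Qed.

Let U : probability (measurableTypeR R) R := uniform_prob (@ltr01 R).

Let measurable_idR : measurable_fun setT (id : measurableTypeR R -> R).
Proof. by move=> _ B mB; rewrite setTI. Qed.

Let U_le (c : \bar R) : 0 <= c <= 1 -> U [set u | u%:E <= c] = c.
Proof.
case: c => [c| |]//; last by rewrite andbC.
rewrite !lee_fin => /andP[c0 c1].
rewrite /U /= /uniform_prob integral_uniform_pdf.
have -> : [set u : R | u%:E <= c%:E] `&` `[0%R, 1%R] = `[0%R, c]%classic.
  apply/seteqP; split => u /=; rewrite !in_itv/= lee_fin.
    by move=> [-> /andP[->]].
  by move=> /andP[-> uc]; split => //; rewrite (le_trans uc).
rewrite (eq_integral (cst 1)); last first.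
  move=> u; rewrite inE /= in_itv /= /uniform_pdf => /andP[u0 uc].
  by rewrite u0 (le_trans uc)//= subr0 invr1.
rewrite integral_cst//= mul1e lebesgue_measure_itv /= lte_fin.
case: ltP => [_|c0']; first by rewrite sube0.
by congr (_%:E); apply/eqP; rewrite eq_le c0 c0'.
Qed.

(* [f (x, u) = inf {q | u <= F q x}] is the conditional quantile function, where
   [F] is the conditional distribution function. *)
Lemma regular_conditional_law_real (Y : Omega -> R) : measurable_fun setT Y ->
  exists f : S * measurableTypeR R -> \bar R, measurable_fun setT f /\
    forall (mf : measurable_fun setT f) D B, measurable D -> measurable B ->
      \int[P]_(w in h @^-1` D) random_map_kernel U mf (h w) B =
        P (h @^-1` D `&` (EFin \o Y) @^-1` B).
Proof.
move=> mY; have [F [F01 Fmono mF FE]] := conditional_cdf P mh mY.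
pose e (n : nat) : rat := odflt 0%R (unpickle n).
have eK q : e (pickle q) = q by rewrite /e pickleK.
pose term n (z : S * measurableTypeR R) : \bar R :=
  if (z.2 : R)%:E <= F (e n) z.1 then (ratr (e n))%:E else +oo.
pose Q z := ereal_inf [set term n z | n in setT].
have mQ : measurable_fun setT Q.
  have -> : Q = fun z => einfs (term ^~ z) 0%N.
    by apply/funext => z; rewrite /Q /einfs /= /sdrop; congr ereal_inf;
      apply/seteqP; split => _ [n _ <-]; exists n.
  apply: (measurable_fun_einfs (f := term)) => n; rewrite /term.
  apply: measurable_fun_ifT; [|exact: measurable_cst|exact: measurable_cst].
  apply: measurable_fun_lee.
    apply/measurable_EFinP; apply: (measurableT_comp measurable_idR).
    exact: measurable_snd.
  exact: (measurableT_comp (mF (e n)) measurable_fst).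
exists Q; split => // {}mQ.
apply: (regular_conditional_law_pi_system _ rational_rayE).
- exact/measurable_EFinP.
- move=> _ _ [p ->] [q ->]; exists (Order.min p q).
  apply/seteqP; split => z /=; rewrite !in_itv /=.
    by have [pq|pq] := leP p q => -[].
  have [pq|pq] := leP p q => zq; split => //; apply: (lt_le_trans zq).
    by rewrite lee_fin ler_rat.
  by rewrite lee_fin ler_rat ltW.
- move=> D _ mD [q ->].
  (* Rationals increasing strictly to [q]: both sides of the identity for the open ray become
     increasing limits along [t]. *)
  pose t (j : nat) : rat := (q - j.+1%:R^-1)%R.
  have tmono i j : (i <= j)%N -> (t i <= t j)%R.
    by move=> ij; rewrite lerB// lef_pV2 ?posrE// ler_nat.
  have tq j : (t j < q)%R by rewrite ltrBlDr ltrDl invr_gt0.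
  have cofinal (x : R) : (x < ratr q)%R -> exists j, (x <= ratr (t j))%R.
    move=> xq; have [j] := ltr_add_invr xq.
    rewrite -ltrBrDr => /ltW xj; exists j.
    by rewrite /t rmorphB /= fmorphV /= ratr_nat.
  (* An infimum is below [q] exactly when one of its terms is, and monotonicity of [F] moves that
     term up to some [t j]. *)
  have QE x : [set u | Q (x, u) < (ratr q)%:E] =
      \bigcup_j [set u | u%:E <= F (t j) x].
    apply/seteqP; split => u /=.
      move=> /ereal_inf_lt[_ [n _ <-]]; rewrite /term /=.
      case: ifPn => //= uF; rewrite lte_fin => /cofinal[j enj].
      exists j => //=; apply: (le_trans uF); apply: Fmono.
      by rewrite -(ler_rat R).
    move=> [j _ /= uF]; apply: (@le_lt_trans _ _ (ratr (t j))%:E).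
      apply: ge_ereal_inf; exists (term (pickle (t j)) (x, u)).
        by exists (pickle (t j)).
      by rewrite /term /= eK uF.
    by rewrite lte_fin ltr_rat.
  have mA (c : \bar R) : measurable [set u : R | u%:E <= c].
    rewrite -[X in measurable X]setTI.
    by apply: measurable_lee => //; exact/measurable_EFinP.
  have cvgK x : F (t j) x @[j --> \oo] -->
      random_map_kernel U mQ x `]-oo, (ratr q)%:E[%classic.
    rewrite random_map_kernelE.
    rewrite (_ : [set u | _] = [set u | Q (x, u) < (ratr q)%:E]); last first.
      by apply/seteqP; split => u /=; rewrite in_itv.
    rewrite QE (_ : (fun j => F (t j) x) =
        U \o (fun j => [set u | u%:E <= F (t j) x])); last first.
      by apply/funext => j; rewrite /comp U_le.
    have mAj j : measurable [set u : measurableTypeR R | u%:E <= F (t j) x].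
      exact: mA.
    apply: nondecreasing_cvg_mu => //; first exact: bigcupT_measurable.
    move=> i j ij; apply/subsetPset => u /= /le_trans; apply.
    exact/Fmono/tmono.
  have mYle (r : R) : measurable [set w | (Y w <= r)%R].
    rewrite -[X in measurable X]setTI.
    have -> : [set w | (Y w <= r)%R] = Y @^-1` `]-oo, r]%classic.
      by apply/seteqP; split => w /=; rewrite in_itv.
    exact: mY.
  have cvgP : P (h @^-1` D `&` [set w | (Y w <= ratr (t j))%R]) @[j --> \oo] -->
      P (h @^-1` D `&` (EFin \o Y) @^-1` `]-oo, (ratr q)%:E[%classic).
    have -> : (EFin \o Y) @^-1` `]-oo, (ratr q)%:E[%classic =
        \bigcup_j [set w | (Y w <= ratr (t j))%R].
      apply/seteqP; split => w /=; rewrite in_itv /= lte_fin.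
        by move=> /cofinal[j]; exists j.
      by move=> [j _ /= /le_lt_trans]; apply; rewrite ltr_rat.
    rewrite setI_bigcupr; apply: nondecreasing_cvg_mu.
    + by move=> j; apply: measurableI => //; exact: mhV.
    + by apply: bigcupT_measurable => j; apply: measurableI => //; exact: mhV.
    + move=> i j ij; apply/subsetPset; apply: setIS => w /= /le_trans; apply.
      by rewrite ler_rat tmono.
  have F0 j x : 0 <= F (t j) x by have /andP[] := F01 (t j) x.
  have mFh j : measurable_fun (h @^-1` D) (fun w => F (t j) (h w)).
    by apply: measurable_funTS; exact: measurableT_comp (mF (t j)) mh.
  (* Monotone convergence; before the limit, the integrals are the probabilities in [cvgP], so the
     two limits coincide. *)
  have cvgI : \int[P]_(w in h @^-1` D) F (t j) (h w) @[j --> \oo] -->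
      \int[P]_(w in h @^-1` D)
        random_map_kernel U mQ (h w) `]-oo, (ratr q)%:E[%classic.
    rewrite (eq_integral (fun w => limn (fun j => F (t j) (h w)))); last first.
      by move=> w _; apply/esym/cvg_lim => //; exact: cvgK.
    apply: cvg_monotone_convergence => //; first exact: mhV.
    by move=> w _ i j ij; exact/Fmono/tmono.
  rewrite (_ : (fun j => _) =
      (fun j => P (h @^-1` D `&` [set w | (Y w <= ratr (t j))%R]))) in cvgI.
    exact: (cvg_unique (@ereal_hausdorff R) cvgI cvgP).
  by apply/funext => j; rewrite FE.
Qed.

(** The conditional law of the real variable [code \o Y] is pushed forward by [decode]. The map
    [fine] intervenes because the quantile function takes extended real values. *)
Lemma regular_conditional_law (E : pmetricType R) (Y : Omega -> borel E) :
  locally_compact [set: E] -> separable_space E -> measurable_fun setT Y ->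
  exists k : R.-pker S ~> borel E, forall D B, measurable D -> measurable B ->
    \int[P]_(w in h @^-1` D) k (h w) B = P (h @^-1` D `&` Y @^-1` B).
Proof.
move=> E_lc E_sep mY.
have [code [decode [mcode mdecode codeK]]] := borel_retract E_lc E_sep.
have [f [mf fE]] := regular_conditional_law_real (measurableT_comp mcode mY).
have mdf : measurable_fun setT (decode \o fine \o f).
  apply: measurableT_comp mf.
  exact: (measurableT_comp mdecode (fine_measurable measurableT)).
exists (random_map_kernel U mdf) => D B mD mB.
have mB' : measurable ((decode \o fine) @^-1` B : set (\bar R)).
  rewrite -[X in measurable X]setTI.
  exact: (measurableT_comp mdecode (fine_measurable measurableT)).
have := fE mf D _ mD mB'.
rewrite (_ : _ @^-1` (_ @^-1` B) = Y @^-1` B)//.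
by apply/seteqP; split => w; rewrite /= codeK.
Qed.

End regular_conditional_law.

(** * Set-indexed Markov processes *)

Section indexing_lemmas.
Context {R : realType} {T : metricType R}.
Variable AA : set (set T).
Hypothesis AA_indexing : indexing_collection AA.
Implicit Types A B U : set T.

Lemma indexing_setI A A' : AA A -> AA A' -> AA (A `&` A').
Proof.
move=> AAA AAA'; have -> : A `&` A' = \bigcap_(V in [set A; A']) V.
  by rewrite bigcap_setU !bigcap_set1.
apply: (indexing_bigcap AA_indexing); last by exists A; left.
by move=> _ [->|->].
Qed.

Lemma finite_unions1 A : AA A -> finite_unions AA A.
Proof.
move=> AAA; exists [set A]; split; last by rewrite bigcup_set1.
- exact: finite_set1.
- by exists A.
- by move=> _ ->.
Qed.

Lemma increment_setI A B A' : increment AA A B -> AA A' ->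
  increment AA (A `&` A') (A `&` A' `&` B).
Proof.
move=> [AAA [F [finF F0 FAA BE]] BA] AAA'; have AAI := indexing_setI AAA AAA'.
split => //.
exists [set A `&` A' `&` V | V in F]; split.
- exact: finite_image.
- by have [V FV] := F0; exists (A `&` A' `&` V); exists V.
- by move=> _ [V FV <-]; apply: indexing_setI => //; exact: FAA.
- by rewrite BE setI_bigcupr bigcup_image.
Qed.

Lemma increment_setU A B A' : increment AA A B -> AA A' ->
  increment AA A (A `&` (A' `|` B)).
Proof.
move=> [AAA [F [finF F0 FAA BE]] BA] AAA'.
split => //; exists ((A `&` A') |` F); split.
- by rewrite finite_setU; split.
- by exists (A `&` A'); left.
- by move=> _ [->|/FAA//]; exact: indexing_setI.
- by rewrite bigcup_setU1 -BE setIUr (setIidr BA).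
Qed.

Lemma increment_index_sub A B U : increment_index AA A B U -> AA U /\ U `<=` B.
Proof.
move=> [[F [H [[_ FAA BE _] HF [V HV] ->]]] _]; split.
  apply: (indexing_bigcap AA_indexing); last by exists V.
  exact: subset_trans FAA.
by move=> x /(_ _ HV) Vx; rewrite BE; exists V => //; exact: HF.
Qed.

(* By the shape property, an extremal component of [A `&` (A' `|` B)] not
   included in [B] is included in [A `&` A'], which is itself included in a
   component; extremality forces both to be equal. *)
Lemma increment_index_setU A B A' U : increment AA A B -> AA A' ->
  increment_index AA A (A `&` (A' `|` B)) U -> U `<=` B \/ U = A `&` A'.
Proof.
move=> [AAA [F [finF F0 FAA BE]] BA] AAA'.
have AAI := indexing_setI AAA AAA'.
move=> [[F2 [H [[[finF2 _] F2AA B2E ext] HF2 [V0 HV0] ->]]] _].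
have [[V HV VB]|nB] := pselect (exists2 V, H V & V `<=` B).
  by left => x /(_ _ HV) /VB.
right.
have VE V : H V -> V = A `&` A'.
  move=> HV; have VA : V `<=` A `&` A'.
    have : V `<=` \bigcup_(W in (A `&` A') |` F) W.
      rewrite bigcup_setU1 -BE -(setIidr BA) -setIUr B2E => x Vx.
      by exists V => //; exact: HF2.
    move=> /(indexing_shape AA_indexing _ _ _)[].
    - exact/F2AA/HF2.
    - by rewrite finite_setU; split.
    - by move=> W [->|/FAA].
    - move=> W [->//|FW VW].
      by case: nB; exists V => //; rewrite BE => x /VW; exists W.
  have [|W F2W IW] := indexing_shape AA_indexing AAI finF2 F2AA.
    rewrite -B2E => x [Ax A'x]; by split => //; left.
  have VW := ext _ _ (HF2 _ HV) F2W (subset_trans VA IW).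
  by apply/seteqP; split => //; move: IW; rewrite -VW.
apply/seteqP; split => x; first by move=> /(_ _ HV0); rewrite (VE _ HV0).
by move=> Ax V /VE ->.
Qed.

Lemma increment_index_empty A : AA A -> increment_index AA A A A.
Proof.
move=> AAA; split; last by right; rewrite setDv.
exists [set A], [set A]; split => //.
- split.
  + by split; [exact: finite_set1|exists A].
  + by move=> _ ->.
  + by rewrite bigcup_set1.
  + by move=> _ _ -> ->.
- by exists A.
- by rewrite bigcap_set1.
Qed.

Lemma increment_empty A : AA A -> increment AA A A.
Proof. by move=> AAA; split => //; exact: finite_unions1. Qed.

End indexing_lemmas.

Section mixture.
Context {R : realType} {d1 d2 d3 : measure_display} {S : measurableType d1}
  {T2 : measurableType d2} {T3 : measurableType d3}.
Variables (mu : {measure set T2 -> \bar R}) (k : R.-ker S ~> T3) (f : T2 -> S).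
Local Open Scope ereal_scope.

(** Turned into a measure in [B], the right side of the Chapman-Kolmogorov equation can be compared
    with the left one on a pi-system. *)
Definition mixture (mf : measurable_fun setT f) (B : set T3) : \bar R :=
  \int[mu]_y k (f y) B.

Hypothesis mf : measurable_fun setT f.

Let mixture0 : mixture mf set0 = 0.
Proof.
by rewrite /mixture (eq_integral (cst 0)) ?integral0// => y _; rewrite measure0.
Qed.

Let mixture_ge0 B : 0 <= mixture mf B. Proof. exact: integral_ge0. Qed.

Let mixture_sigma_additive : semi_sigma_additive (mixture mf).
Proof.
move=> F mF tF mUF; rewrite [X in _ --> X](_ : _ =
  \int[mu]_y (\sum_(n <oo) k (f y) (F n))); last first.
  by apply: eq_integral => y _; rewrite measure_semi_bigcup.
apply/cvg_closeP; split.
  by apply: is_cvg_nneseries => n _ _; exact: integral_ge0.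
rewrite closeE// integral_nneseries// => n.
exact: measurableT_comp (measurable_kernel k _ (mF n)) mf.
Qed.

HB.instance Definition _ := isMeasure.Build _ _ R
  (mixture mf) mixture0 mixture_ge0 mixture_sigma_additive.

End mixture.

Section comp_kernel.
Context {R : realType} {d1 d2 d3 : measure_display} {T1 : measurableType d1}
  {S : measurableType d2} {T2 : measurableType d3}.
Variables (k : R.-pker S ~> T2) (f : T1 -> S).

Definition comp_kernel (mf : measurable_fun setT f) (x : T1) :
  {measure set T2 -> \bar R} := k (f x).

Hypothesis mf : measurable_fun setT f.

Let measurable_comp_kernel B : measurable B ->
  measurable_fun setT (comp_kernel mf ^~ B).
Proof. by move=> mB; exact: measurableT_comp (measurable_kernel k _ mB) mf. Qed.

HB.instance Definition _ := isKernel.Build _ _ _ _ R (comp_kernel mf)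
  measurable_comp_kernel.

Let comp_kernel_prob x : comp_kernel mf x setT = 1%E.
Proof. exact: prob_kernel. Qed.

HB.instance Definition _ := Kernel_isProbability.Build _ _ _ _ R
  (comp_kernel mf) comp_kernel_prob.

End comp_kernel.

Section state_space.
Context {R : realType} {T : metricType R} {E : pmetricType R}.
Variables (AA : set (set T)) (A B : set T).

Lemma measurable_state_component (i : {U : set T | increment_index AA A B U}) :
  measurable_fun setT (fun x : state AA A B => x i : borel E).
Proof.
move=> _ G mG; rewrite setTI; apply: sub_sigma_algebra.
by exists i, G.
Qed.

Lemma measurable_to_state d (S : measurableType d) (f : S -> state AA A B) :
  (forall i, measurable_fun setT (fun x => f x i : borel E)) ->
  measurable_fun setT f.
Proof.
move=> mf; apply: (@measurability _ _ S (state AA A B) setT f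
  (@cylinders _ E {U : set T | increment_index AA A B U})) => //.
move=> _ [_ [i [G [mG ->]]] <-].
exact: mf.
Qed.

End state_space.

(** * Strong histories and the Chapman-Kolmogorov equation *)

Section set_indexed_markov.
Context {R : realType} {T : metricType R} {E : pmetricType R}.
Hypotheses (E_lc : locally_compact [set: E]) (E_sep : separable_space E).
Variable AA : set (set T).
Hypothesis AA_indexing : indexing_collection AA.
Context {d : measure_display} {Omega : measurableType d}.
Variables (P : probability Omega R) (FF : set T -> set_system Omega).
Hypothesis FF_filtration : filtration P AA FF.
Variable X : set T -> Omega -> E.
Hypothesis X_Markov : C_Markov P AA FF X.
Implicit Types A B C U : set T.

Let X_adapted : adapted AA FF X. Proof. by case: X_Markov. Qed.

Lemma strong_history_sigma_algebra C :
  sigma_algebra setT (strong_history AA FF C).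
Proof. exact: smallest_sigma_algebra. Qed.

Lemma strong_history_measurable C : strong_history AA FF C `<=` measurable.
Proof.
apply: smallest_sub; first exact: sigma_algebra_measurable.
move=> D [B _]; move: D; apply: smallest_sub.
  exact: sigma_algebra_measurable.
by move=> D [A [AAA _]]; exact: (filtration_measurable FF_filtration).
Qed.

(** A smaller increment is disjoint from more sets of the class of finite unions. *)
Lemma strong_history_anti C1 C2 : C2 `<=` C1 ->
  strong_history AA FF C1 `<=` strong_history AA FF C2.
Proof.
move=> C21; apply: sub_sigma_algebra2 => D [B [fB BC1] DB].
exists B => //; split => //.
by rewrite -subset0 -BC1; exact: setIS.
Qed.

Lemma strong_history_process C U (G : set (borel E)) : AA U -> U `&` C = set0 ->
  measurable G -> strong_history AA FF C (X U @^-1` G).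
Proof.
move=> AAU UC mG; apply: sub_sigma_algebra; exists U.
  by split => //; exact: finite_unions1.
by apply: sub_sigma_algebra; exists U; [split|exact: X_adapted].
Qed.

Lemma measurable_process A : AA A -> measurable_fun setT (X A : Omega -> borel E).
Proof.
move=> AAA _ G mG; rewrite setTI.
exact/(filtration_measurable FF_filtration AAA)/X_adapted.
Qed.

Let measurable_preimage A (G : set (borel E)) : AA A -> measurable G ->
  measurable (X A @^-1` G).
Proof.
move=> AAA mG; rewrite -[X in measurable X]setTI; exact: measurable_process.
Qed.

Lemma measurable_process_at A B :
  measurable_fun setT (process_at AA X A B).
Proof.
apply: measurable_to_state => -[U UAB] /=.
by have [/measurable_process] := increment_index_sub AA_indexing UAB.
Qed.

Notation history C := (g_sigma_algebraType (strong_history AA FF C)).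

Lemma history_measurable_process C U : AA U -> U `&` C = set0 ->
  measurable_fun setT (X U : history C -> borel E).
Proof.
move=> AAU UC _ G mG; rewrite setTI measurable_g_measurableTypeE.
  exact: strong_history_process.
exact: strong_history_sigma_algebra.
Qed.

Lemma history_measurable_process_at C A B : B `&` C = set0 ->
  measurable_fun setT (process_at AA X A B : history C -> state AA A B).
Proof.
move=> BC; apply: measurable_to_state => -[U UAB] /=.
have [AAU UB] := increment_index_sub AA_indexing UAB.
apply: history_measurable_process => //.
by rewrite -subset0 -BC; exact: setSI.
Qed.

Let bounded_integrable (Z : Omega -> \bar R) : measurable_fun setT Z ->
  (forall w, 0 <= Z w <= 1)%E -> P.-integrable setT Z.
Proof.
move=> mZ Z01; apply: (@le_integrable _ _ _ P setT _ Z (cst 1%E)) => //.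
  move=> w _; have /andP[Z0 Z1] := Z01 w.
  by rewrite gee0_abs// gee0_abs.
apply/integrableP; split => //.
under eq_integral do rewrite gee0_abs//.
by rewrite integral_cst// mul1e -ge0_fin_numE// fin_num_measure.
Qed.

Lemma cond_exp_preimage d' (S : measurableType d') (h : Omega -> S)
    (g : S -> \bar R) (F : set Omega) :
  measurable_fun setT h -> measurable_fun setT g ->
  (forall s, 0 <= g s <= 1)%E -> measurable F ->
  (forall D, measurable D ->
    \int[P]_(w in h @^-1` D) g (h w) = P (h @^-1` D `&` F))%E ->
  {ae P, forall w,
    g (h w) = (cond_exp P (g_sigma_algebra_preimage h) \1_F w)%:E}.
Proof.
move=> mh mg g01 mF gE.
have sG : sigma_algebra setT (g_sigma_algebra_preimage h).
  by apply: sigma_algebra_preimage; exact: sigma_algebra_measurable.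
have mG : g_sigma_algebra_preimage h `<=` measurable.
  by move=> _ [D mD <-]; exact: mh.
apply: (cond_prob_version_cond_exp sG mG mF); split.
- move=> _ B mB; rewrite setTI measurable_g_measurableTypeE//.
  exists (g @^-1` B); last by rewrite setTI.
  by rewrite -[X in measurable X]setTI; exact: mg.
- by apply: bounded_integrable => //; exact: measurableT_comp mg mh.
- by move=> _ [D mD <-]; rewrite setTI; exact: gE.
Qed.

(** For an empty increment [X A] is itself a component of the conditioning vector, so the indicator
    of the event is its own conditional expectation. *)
Lemma cond_exp_dirac A (G : set (borel E)) : AA A -> measurable G ->
  {ae P, forall w, \d_(X A w : borel E) G =
    (cond_exp P (g_sigma_algebra_preimage (process_at AA X A A))
       \1_(X A @^-1` G) w)%:E}.
Proof.
move=> AAA mG; have iA := increment_index_empty AAA.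
pose i : {U | increment_index AA A A U} := exist _ A iA.
apply: (@cond_exp_preimage _ _ _ (fun s : state AA A A => \d_(s i : borel E) G)).
- exact: measurable_process_at.
- have mi := @measurable_state_component _ _ E _ _ _ i.
  exact: (measurable_kernel (kdirac (R := R) mi) _ mG).
- by move=> s; rewrite /dirac indicE; case: (_ \in _); rewrite ?lexx ?lee01.
- exact: measurable_preimage.
- move=> D mD; rewrite [X in _ = P X]setIC -integral_indic//.
    by rewrite -[X in measurable X]setTI; exact: measurable_process_at.
  exact: measurable_preimage.
Qed.

Lemma conditional_laws_exist : exists p : @transition_family R T E AA,
  conditional_laws P X p /\ empty_is_dirac (globally setT) p.
Proof.
have law A B : exists k : R.-pker (state AA A B) ~> (borel E),
    (increment AA A B -> forall G : set (borel E), measurable G ->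
      {ae P, forall w, k (process_at AA X A B w) G =
        (cond_exp P (g_sigma_algebra_preimage (process_at AA X A B))
           \1_(X A @^-1` G) w)%:E}) /\
    (A = B -> AA A -> forall (x : set T -> E) (G : set (borel E)),
      k (restr AA A B x) G = \d_(x A : borel E) G).
  (* For a pair that is not an increment, a constant Dirac kernel fills the place. *)
  have [AB|nAB] := pselect (increment AA A B); last first.
    exists (kdirac (measurable_cst (point : borel E))); split => // ABE AAA.
    by case: nAB; rewrite -ABE; exact: increment_empty.
  (* For an empty increment the Dirac kernel is chosen, so that the second clause holds at every
     state and not just almost surely. *)
  have [AAA _ _] := AB; have [ABE|AneB] := pselect (A = B).
    move: AB; rewrite -ABE => _.
    have iA := increment_index_empty AAA.
    pose i : {U | increment_index AA A A U} := exist _ A iA.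
    pose k : R.-pker (state AA A A) ~> (borel E) :=
      kdirac (@measurable_state_component _ _ _ _ _ _ i).
    exists k; split => // _ G mG.
    exact: cond_exp_dirac.
  have [k kE] := regular_conditional_law P (@measurable_process_at A B)
    E_lc E_sep (measurable_process AAA).
  exists k; split => // _ G mG.
  apply: (@cond_exp_preimage _ _ _ (k ^~ G)) => //.
  - exact: measurable_process_at.
  - exact: measurable_kernel.
  - move=> s; rewrite measure_ge0 -(prob_kernel (s := k) s).
    by apply: le_measure; rewrite ?inE//; exact: measurableT.
  - exact: measurable_preimage.
  - by move=> D mD; exact: kE.
exists (fun A B => projT1 (cid (law A B))); split.
  by move=> A B AB; case: cid => k /= [kl _]; exact: kl.
by move=> A AAA x _ G mG; case: cid => k /= [_ kd]; exact: kd.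
Qed.

Section conditional_laws.
Variable p : @transition_family R T E AA.
Hypothesis pX : conditional_laws P X p.
Local Open Scope ereal_scope.

(** This is where the Markov property enters: applied to the indicator of [G], it lets the
    sigma-algebra of the vector [X_C] be replaced by the whole strong history. *)
Lemma strong_history_integral A B D (G : set (borel E)) : increment AA A B ->
  measurable G -> strong_history AA FF (A `\` B) D ->
  \int[P]_(w in D) p A B (process_at AA X A B w) G = P (D `&` X A @^-1` G).
Proof.
move=> AB mG HD; have [AAA _ _] := AB.
apply: (integral_ae_cond_exp (strong_history_sigma_algebra _)
  (@strong_history_measurable _) _ HD).
- exact: measurable_preimage.
- exact: measurableT_comp (measurable_kernel (p A B) _ mG)
    (@measurable_process_at A B).
have mf : measurable_fun setT (\1_G : borel E -> R) by exact: measurable_indic.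
have bf : [bounded (\1_G : borel E -> R) x | x in setT].
  exists 1%R; split => // M M1 x _ /=.
  by rewrite ger0_norm// (le_trans _ (ltW M1))// indicE lern1 leq_b1.
have [_ /(_ A B AB _ mf bf)] := X_Markov.
rewrite (_ : \1_G \o X A = \1_(X A @^-1` G))//.
by apply: filterS2 (pX AB mG) => w -> ->.
Qed.

Let prob_kernel_le1 A B s (G : set (borel E)) : measurable G ->
  p A B s G <= 1.
Proof.
move=> mG; rewrite -(prob_kernel (s := p A B) s).
by apply: le_measure; rewrite ?inE//; exact: measurableT.
Qed.

Lemma chapman_kolmogorov_set A B A' (G : set (borel E)) :
  increment AA A B -> AA A' -> measurable G ->
  {ae P, forall w,
    p A B (process_at AA X A B w) G =
    \int[p (A `&` A') (A `&` A' `&` B) (process_at AA X _ _ w)]_y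
      p A (A `&` (A' `|` B))
        (restr AA _ _ (update (fun U => X U w) (A `&` A') y)) G}.
Proof.
move=> AB AAA' mG; have [AAA _ BA] := AB.
set A1 := A `&` A'; set B1 := A1 `&` B; set B2 := A `&` (A' `|` B).
have AB1 : increment AA A1 B1 by exact: increment_setI.
have AB2 : increment AA A B2 by exact: increment_setU.
have AAA1 : AA A1 by case: AB1.
pose C := A `\` B.
have BC : B `&` C = set0 by rewrite setDIK.
have mid := measurable_id_sub_sigma_algebra
  (strong_history_sigma_algebra C) (@strong_history_measurable C).
have C1C : A1 `\` B1 `<=` C.
  by move=> x [[Ax A'x] nB]; split => // Bx; exact: nB.
have C2C : A `\` B2 `<=` C.
  by move=> x [Ax nB]; split => // Bx; apply: nB; split => //; right.
pose s1 : history C -> state AA A1 B1 := process_at AA X A1 B1.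
have ms1 : measurable_fun setT s1.
  by apply: history_measurable_process_at; rewrite /B1 -setIA BC setI0.
(* The first argument carries the components measurable for the history of [C], the second is the
   integration variable. *)
pose s2 (z : history C * borel E) : state AA A B2 :=
  restr AA A B2 (update (fun U => X U z.1) A1 z.2).
have ms2 : measurable_fun setT s2.
  apply: measurable_to_state => -[U UB2]; rewrite /s2 /restr /update /=.
  have [AAU _] := increment_index_sub AA_indexing UB2.
  case: asboolP => [_|UA1]; first exact: measurable_snd.
  have [UB|//] := increment_index_setU AA_indexing AB AAA' UB2.
  apply: (measurableT_comp (f := X U : history C -> borel E)).
    apply: history_measurable_process => //.
    by rewrite -subset0 -BC; exact: setSI.
  exact: measurable_fst.
have s2X w : s2 (w, X A1 w) = process_at AA X A B2 w.
  congr (restr AA A B2 _); apply/funext => U; rewrite /update.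
  by case: asboolP => [->|].
pose H z := p A B2 (s2 z) G.
have mH : measurable_fun setT H.
  exact: measurableT_comp (measurable_kernel (p A B2) _ mG) ms2.
pose k : R.-pker history C ~> borel E := comp_kernel (p A1 B1) ms1.
pose Z (w : history C) := \int[k w]_y H (w, y).
have mZ : measurable_fun setT Z.
  by apply: (measurable_fun_integral_finite_kernel H k).
(* The first three goals concern the left side of the equation, the last three the right side
   [Z]. *)
apply: (@cond_prob_version_unique _ _ _ P _ (strong_history_sigma_algebra C)
  (@strong_history_measurable C) (X A @^-1` G) _ Z); split.
- apply: measurableT_comp (measurable_kernel (p A B) _ mG) _.
  exact: history_measurable_process_at.
- apply: bounded_integrable => [|w].
    exact: measurableT_comp (measurable_kernel (p A B) _ mG)
      (@measurable_process_at A B).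
  by rewrite measure_ge0 prob_kernel_le1.
- by move=> D HD; exact: strong_history_integral.
- exact: mZ.
- apply: bounded_integrable => [|w]; first exact: (measurableT_comp mZ mid).
  rewrite integral_ge0//= -(prob_kernel (s := k) w).
  rewrite -[leRHS]mul1e -integral_cst//.
  apply: ge0_le_integral => //; first exact: measurable_fun_pair2 mH.
  by move=> y _; exact: prob_kernel_le1.
- move=> D HD; have mD := strong_history_measurable HD.
  have mD' : (measurable : set (set (history C))) D by exact: sub_sigma_algebra.
  pose f (z : history C * borel E) := if z.1 \in D then H z else 0.
  have mf : measurable_fun setT f.
    apply: measurable_fun_ifT; [|exact: mH|exact: measurable_cst].
    apply: (measurable_fun_bool true); rewrite setTI.
    rewrite (_ : _ @^-1` _ = fst @^-1` D).
      rewrite -[X in measurable X]setTI; exact: measurable_fst.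
    by apply/seteqP; split => z /= Dz; [exact: set_mem|exact: mem_set].
  have f0 z : 0 <= f z by rewrite /f; case: ifP.
  (* The history of [C] is contained in that of the smaller increment [C'], so [p A1 B1] is also the
     conditional law of [X A1] given the history of [C]. *)
  have kE D1 (G1 : set (borel E)) : (measurable : set (set (history C))) D1 ->
      measurable G1 -> \int[P]_(w in id @^-1` D1) k w G1 =
        P (id @^-1` D1 `&` X A1 @^-1` G1).
    rewrite !preimage_id measurable_g_measurableTypeE; last first.
      exact: strong_history_sigma_algebra.
    move=> HD1 mG1; apply: strong_history_integral => //.
    exact: (strong_history_anti C1C).
  have fE := disintegration mid (measurable_process AAA1) kE mf f0.
  (* The event [D] also belongs to the history of [C''], which brings in [p A B2]; at [y = X A1 w]
     the updated path is the path itself. *)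
  rewrite -(strong_history_integral AB2 mG (strong_history_anti C2C HD)).
  rewrite [RHS]integral_mkcond [LHS]integral_mkcond.
  transitivity (\int[P]_w \int[k w]_y f (w, y)).
    apply: eq_integral => w _; rewrite patchE /f /=.
    by case: ifP => // _; rewrite integral0.
  rewrite -fE.
  by apply: eq_integral => w _; rewrite patchE /f /= /H s2X.
Qed.

Lemma conditional_laws_chapman_kolmogorov :
  chapman_kolmogorov (path_law P X) p.
Proof.
move=> A B A' AB AAA'.
have [c cE] := dense_sequence E_sep.
(* Numbering the pi-system by integers leaves a countable union of null sets; integers that code no
   sequence give the whole space. *)
have : {ae P, forall w, forall n,
    let G := finite_meet c (odflt [::] (unpickle n)) in
    p A B (process_at AA X A B w) G =
    \int[p (A `&` A') (A `&` A' `&` B) (process_at AA X _ _ w)]_y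
      p A (A `&` (A' `|` B))
        (restr AA _ _ (update (fun U => X U w) (A `&` A') y)) G}.
  apply/ae_foralln => n; apply: chapman_kolmogorov_set => //.
  exact: measurable_finite_meet.
apply: filterS => w wE G mG.
pose u (y : borel E) : state AA A (A `&` (A' `|` B)) :=
  restr AA _ _ (update (fun U => X U w) (A `&` A') y).
have mu : measurable_fun setT u.
  apply: measurable_to_state => -[U UB2]; rewrite /u /restr /update /=.
  case: asboolP => _; first exact: measurable_id.
  exact: measurable_cst.
pose m := mixture (p (A `&` A') (A `&` A' `&` B) (process_at AA X _ _ w))
  (p A (A `&` (A' `|` B))) mu.
apply: (eq_measure_finite_meet cE (m2 := m)) => //.
  by rewrite prob_kernel ltry.
by move=> s; have := wE (pickle s); rewrite pickleK.
Qed.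

Lemma conditional_laws_empty_is_dirac : empty_is_dirac (path_law P X) p.
Proof.
move=> A AAA; have AA_ := increment_empty AAA.
have [c cE] := dense_sequence E_sep.
have : {ae P, forall w, forall n,
    let G := finite_meet c (odflt [::] (unpickle n)) in
    p A A (process_at AA X A A w) G = \d_(X A w : borel E) G}.
  apply/ae_foralln => n /=; set G := finite_meet _ _.
  have mG : measurable G by exact: measurable_finite_meet.
  by apply: filterS2 (pX AA_ mG) (cond_exp_dirac AAA mG) => w -> ->.
apply: filterS => w wE G mG.
apply: (eq_measure_finite_meet cE (m2 := \d_(X A w : borel E))) => //.
  by rewrite prob_kernel ltry.
by move=> s; have := wE (pickle s); rewrite pickleK.
Qed.

End conditional_laws.

End set_indexed_markov.

(** Conditional laws are determined only up to null sets, hence the two halves: some version is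
    Dirac on empty increments at every state, and every version satisfies both identities along
    almost every path of [X]. For given index sets, one null set serves all Borel sets. *)
Theorem proposition2p4 (R : realType)
    (T : metricType R) (T_lc : locally_compact [set: T])
    (E : pmetricType R) (E_lc : locally_compact [set: E])
    (E_sep : separable_space E)
    (AA : set (set T)) (AA_indexing : indexing_collection AA)
    (d : measure_display) (Omega : measurableType d)
    (P : probability Omega R) (P_complete : measure_is_complete P)
    (FF : set T -> set_system Omega) (FF_filtration : filtration P AA FF)
    (X : set T -> Omega -> E) (X_Markov : C_Markov P AA FF X) :
  (exists p : transition_family AA,
     conditional_laws P X p /\ empty_is_dirac (globally setT) p) /\
  (forall p : transition_family AA, conditional_laws P X p ->
     C_transition_system (path_law P X) p).
Proof.
split; first exact: (conditional_laws_exist E_lc E_sep AA_indexing FF_filtration).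
move=> p pX; split.
  exact: (conditional_laws_empty_is_dirac E_sep AA_indexing FF_filtration).
exact: (conditional_laws_chapman_kolmogorov E_sep AA_indexing FF_filtration).
Qed.
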